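(* Fix $\kappa\in(0,1/3)$. There exist $C>0$ and an integer $L_0\ge1$ such that for all $L\ge L_0$ and all $x_0\in Q_{R_L-r_L}$, on the event $E_{L,x_0}=E_{L,x_0}(\kappa)$, $$\big|\lambda_1(Q_{R_L},\xi_L)-\bar\lambda_L-\Xi_L(x_0)\big|\le C\frac{d_L}{a_L}\Big(\Big(\frac{d_L}{a_L}\Big)^{1-2\kappa}|\xi_L(x_0)-a_L|+\frac1{a_L}\Big),$$ and $$\|\varphi_{R_L}-\bar\varphi_L(\cdot-x_0)\|_{\ell^2(Q_{R_L})}\le C\frac{d_L}{a_L}\sqrt{\Big(\frac{d_L}{a_L}\Big)^{1-2\kappa}|\xi_L(x_0)-a_L|+\frac1{a_L}},$$ where $\bar\varphi_L$ is extended by $0$ outside $Q_{r_L}$.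
   Context: Fix $d\ge1$; $|x|$ Euclidean norm; $Q_a=[-a/2,a/2]^d\cap\mathbb{Z}^d$, $Q_{a,x}=x+Q_a$, $Q_a^{\neq0}=Q_a\setminus\{0\}$; $u_L\ll v_L$ means $u_L/v_L\to0$. For each $L\ge1$, $(\xi_L(x))_{x\in\mathbb{Z}^d}$ is a centred shift-stationary Gaussian field with unit variance and non-negative covariance $v_L$ with (I) $\sup_{|x|\ge\exp(\sqrt{\ln L})}v_L(x)\ln|x|\to0$; (II) there are $\mathfrak c,\mathfrak c'>0$ with $1-e^{\mathfrak c'|x|}/d_L\le v_L(x)\le1-\mathfrak c/d_L$ for all $L,x\ne0$, where $\sup_{|x|=1}v_L(x)=1-1/d_L$. $a_L$: $\mathbb{P}(\xi_L(0)>a_L)=L^{-d}$. Fix $R_L,r_L$ with $a_L\ll\ln R_L\ll a_L^2/d_L$, $\ln a_L\le\ln r_L\ll\sqrt{a_L}$. $\Delta f(x)=\sum_{|y-x|=1}(f(y)-f(x))$; Dirichlet operators act on functions extended by $0$ outside the domain. $\lambda_1(Q_{R_L},\xi_L)$ and $\varphi_{R_L}\ge0$: principal eigenvalue and $\ell^2$-normalised eigenfunction of $\Delta+\xi_L$ on $Q_{R_L}$ (Dirichlet). $\mathcal{S}_L(x)=a_L(1-v_L(x))$; $\bar\lambda_L,\bar\varphi_L\ge0$: principal eigenvalue and normalised eigenfunction of $\Delta-\mathcal{S}_L$ on $Q_{r_L}$ (Dirichlet). $\zeta_{L,x_0}(x)=\xi_L(x)-\xi_L(x_0)v_L(x-x_0)$;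 $\Phi_L(y)=\sum_{x\in Q_{r_L}^{\neq0}}\bar\varphi_L(x)^2\zeta_{L,y}(x+y)$; $\tau_L^2=\mathrm{Var}(\Phi_L(y))$; $\Xi_L=\xi_L+\Phi_L$. Standing assumptions: $d_L\ll a_L$, $\tau_L\ll a_L^{-1}(a_L/d_L)^{1/2}$. With $\theta=2d+1$: $E_{L,x_0}(\kappa)=E^1\cap E^2\cap E^3$ with $E^1=\{|\xi_L(x_0)-a_L|<\theta\}$, $E^2=\{|\zeta_{L,x_0}(x)|\le\frac1{10}\mathcal{S}_L(x-x_0)\ \forall x\in Q_{2R_L,x_0}\}$, $E^3=\bigcap_{x\in Q_{R_L,x_0}\setminus\{x_0\}}\{|\zeta_{L,x_0}(x)|/\sqrt{\mathrm{Var}[\zeta_{L,x_0}(x)]}\le(a_L/d_L)^{\kappa|x-x_0|}\sqrt{1\vee(|\xi_L(x_0)-a_L|a_L)}\}$. *)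

(* Defs.v *)
From HB Require Import structures.
From mathcomp Require Import all_boot all_order all_algebra.
From mathcomp Require Import all_classical all_reals all_analysis.
Set Implicit Arguments.
Unset Strict Implicit.
Unset Printing Implicit Defensive.
Import Order.TTheory GRing.Theory Num.Theory.
Local Open Scope ring_scope.
Local Open Scope classical_set_scope.

Notation Zpt d := {ffun 'I_d -> int}.

Definition unitv (d : nat) (i : 'I_d) : Zpt d := [ffun j => ((i == j) : nat)%:Z].

Definition enorm {R : realType} (d : nat) (x : Zpt d) : R :=
  Num.sqrt (\sum_(i < d) ((x i)%:~R : R) ^+ 2).

(* x \in Q_a = [-a/2, a/2]^d \cap Z^d  (so x \in Q_{a,y} iff inbox a (x - y)). *)
Definition inbox {R : realType} (d : nat) (a : R) (x : Zpt d) : bool :=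
  [forall i, `|((x i)%:~R : R)| <= a / 2].

Definition cube (d N : nat) : seq (Zpt d) :=
  [seq [ffun i => (k i : nat)%:Z - N%:Z] | k : {ffun 'I_d -> 'I_(N.*2.+1)}].

Definition box {R : realType} (d : nat) (a : R) : seq (Zpt d) :=
  [seq x <- cube d `|Num.floor (`|a| / 2)|%N | inbox a x].

Definition lap {R : realType} (d : nat) (f : Zpt d -> R) (x : Zpt d) : R :=
  \sum_(i < d) ((f (x + unitv i) - f x) + (f (x - unitv i) - f x)).

Definition dirichlet_eigen {R : realType} (d : nat) (a : R) (V : Zpt d -> R)
    (lam : R) (f : Zpt d -> R) : Prop :=
  [/\ (forall x, ~~ inbox a x -> f x = 0),
      (exists x, f x != 0) &
      (forall x, inbox a x -> lap f x + V x * f x = lam * f x)].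

Definition principal_eigenpair {R : realType} (d : nat) (a : R) (V : Zpt d -> R)
    (lam : R) (f : Zpt d -> R) : Prop :=
  [/\ dirichlet_eigen a V lam f,
      (forall mu g, dirichlet_eigen a V mu g -> mu <= lam),
      (forall x, 0 <= f x) &
      \sum_(x <- box d a) f x ^+ 2 = 1].

Definition l2box {R : realType} (d : nat) (a : R) (f : Zpt d -> R) : R :=
  Num.sqrt (\sum_(x <- box d a) f x ^+ 2).

Definition centred_gaussian_law {R : realType} (s2 : R) (A : set R) : \bar R :=
  if s2 == 0 then ((\1_A : R -> R) 0)%:E else normal_prob 0 (Num.sqrt s2) A.

(* xi is a centred Gaussian field on Z^d with covariance E[xi x xi y] = v (x - y):
   every finite linear combination sum c_k xi(x_k) is N(0, sum c_k c_l v(x_k - x_l)). *)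
Definition gaussian_field {R : realType} {dT : measure_display}
    {T : measurableType dT} (P : probability T R) (d : nat)
    (xi : Zpt d -> T -> R) (v : Zpt d -> R) : Prop :=
  (forall x, measurable_fun setT (xi x)) /\
  (forall (s : seq (Zpt d * R)) (A : set R), measurable A ->
     P ((fun w => \sum_(p <- s) p.2 * xi p.1 w) @^-1` A) =
     centred_gaussian_law (\sum_(p <- s) \sum_(q <- s) p.2 * q.2 * v (p.1 - q.1)) A).

Definition negl {R : realType} (u w : nat -> R) : Prop :=
  (\forall L \near \oo, w L != 0) /\ ((fun L => u L / w L) @ \oo --> 0).

Definition zeta {R : realType} {T : Type} (d : nat) (xi : Zpt d -> T -> R)
    (v : Zpt d -> R) (x0 x : Zpt d) (w : T) : R :=
  xi x w - xi x0 w * v (x - x0).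

Definition Phi {R : realType} {T : Type} (d : nat) (xi : Zpt d -> T -> R)
    (v : Zpt d -> R) (r : R) (phibar : Zpt d -> R) (y : Zpt d) (w : T) : R :=
  \sum_(x <- box d r | x != 0) phibar x ^+ 2 * zeta xi v y (x + y) w.

Definition Xi {R : realType} {T : Type} (d : nat) (xi : Zpt d -> T -> R)
    (v : Zpt d -> R) (r : R) (phibar : Zpt d -> R) (y : Zpt d) (w : T) : R :=
  xi y w + Phi xi v r phibar y w.

(* The event E_{L,x0}(kappa) (for fixed L), with theta = 2d+1, S(x) = a(1 - v(x)). *)
Definition Eevent {R : realType} {dT : measure_display} {T : measurableType dT}
    (P : probability T R) (d : nat) (xi : Zpt d -> T -> R) (v : Zpt d -> R)
    (a dd RR kappa : R) (x0 : Zpt d) (w : T) : Prop :=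
  [/\ `|xi x0 w - a| < (2 * d + 1)%:R,
      (forall x, inbox (2 * RR) (x - x0) ->
         `|zeta xi v x0 x w| <= 10^-1 * (a * (1 - v (x - x0)))) &
      (forall x, inbox RR (x - x0) -> x != x0 ->
         `|zeta xi v x0 x w| / Num.sqrt (fine ('V_P[zeta xi v x0 x])%E)
           <= (a / dd) `^ (kappa * enorm (x - x0)) *
              Num.sqrt (Num.max 1 (`|xi x0 w - a| * a)))].

(* Main.v *)
(** Write [xi = xi(x0) v(. - x0) + zeta].  On the event, [xi] is at most
[xi(x0) - m] off [x0], with [m] of order [a / D]; hence so is the quadratic form
of [Delta + xi] on functions vanishing at [x0].  As these have codimension one,
the principal eigenvalue, which positivity of [phi] bounds below by
[xi(x0) - 2 d], is separated from the rest of the spectrum by a gap of order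
[m].  Let [psi] be the translate of [phibar] to [x0], let [rho] be its residual
for the approximate eigenvalue [lbar + xi(x0)], and split [psi] into its
projection on [phi] and an orthogonal part [w].  The gap gives
[|w| = O(|rho| / m)], hence the same bound for [|phi - psi|] and an error
[O(|rho|^2 / m)] for the eigenvalue beyond the first-order term [<rho, psi>],
which is [Phi] up to [O(D / a^2)].  It remains to bound [|rho|^2].  Off the
origin [phibar] is at most [1 / m] times the sum of its neighbouring values, so
it decays like [(2 d / m)^|x|], which beats the growth of [1 - v] and, by the
bound on the variance of [zeta], that of [zeta^2]; and as [r >= a] only mass
[O(1 / a)] is lost at the boundary of the box of [phibar]. *)

Require Import Defs.
From HB Require Import structures.
From mathcomp Require Import all_boot all_order all_algebra.
From mathcomp Require Import all_classical all_reals all_analysis.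
From mathcomp Require Import measurable_realfun.
From mathcomp Require Import ring lra zify.
Import Order.TTheory GRing.Theory Num.Theory.
Local Open Scope ring_scope.
Local Open Scope classical_set_scope.

Set Implicit Arguments.
Unset Strict Implicit.
Unset Printing Implicit Defensive.

(** * Sums over lattice boxes *)

Section finite_sums.
Context {R : realDomainType} {T : eqType}.
Implicit Types (s : seq T) (f : T -> R).

Lemma ler_term_sum s f x : (forall y, 0 <= f y) -> x \in s ->
  f x <= \sum_(y <- s) f y.
Proof. by move=> f0 xs; rewrite (big_rem x)//= lerDl sumr_ge0. Qed.

Lemma sqr_sum_le_size s f :
  (\sum_(x <- s) f x) ^+ 2 <= (size s)%:R * \sum_(x <- s) f x ^+ 2.
Proof.
elim: s => [|x s IH]; first by rewrite !big_nil expr0n mulr0.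
rewrite !big_cons /= -natr1; move: IH.
set S := \sum_(y <- s) f y; set Q := \sum_(y <- s) _.
have cross : f x * S *+ 2 <= (size s)%:R * f x ^+ 2 + Q.
  have -> : (size s)%:R * f x ^+ 2 = \sum_(y <- s) f x ^+ 2.
    by rewrite big_const_seq count_predT iter_addr_0 mulr_natl.
  rewrite /S mulr_sumr -sumrMnl -big_split/=.
  by apply: ler_sum => y _; have := sqr_ge0 (f x - f y); rewrite sqrrB; lra.
by rewrite sqrrD; lra.
Qed.

Lemma sum_sqr_le_sqr_sum s f : (forall x, 0 <= f x) ->
  \sum_(x <- s) f x ^+ 2 <= (\sum_(x <- s) f x) ^+ 2.
Proof.
move=> f0; rewrite expr2 mulr_suml !big_seq; apply: ler_sum => x xs.
by rewrite expr2 ler_wpM2l// -big_seq ler_term_sum.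
Qed.

End finite_sums.

Lemma sqr_le_norm_div_sqrt {R : rcfType} (z V p N : R) : 0 < V -> 0 <= N -> 0 <= p ->
  `|z| / Num.sqrt V <= p * Num.sqrt N -> z ^+ 2 <= p ^+ 2 * N * V.
Proof.
move=> V0 N0 p0; rewrite ler_pdivrMr ?sqrtr_gt0// => z_le.
rewrite -(real_normK (num_real z)) -(sqr_sqrtr N0) -(sqr_sqrtr (ltW V0)) -!exprMn.
by apply: lerXn2r z_le; rewrite nnegrE ?mulr_ge0.
Qed.

Section lattice.
Context {R : realType} {d : nat}.
Implicit Types (a b : R) (x y u : Zpt d).

Definition supported a (f : Zpt d -> R) := forall x, ~~ inbox a x -> f x = 0.

Lemma inboxP a x : reflect (forall i, `|(x i)%:~R : R| <= a / 2) (inbox a x).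
Proof. exact: forallP. Qed.

Lemma inboxD a b x y : inbox a x -> inbox b y -> inbox (a + b) (x + y).
Proof.
move=> /inboxP xa /inboxP yb; apply/inboxP => i; rewrite ffunE rmorphD/=.
by rewrite (le_trans (ler_normD _ _))// mulrDl lerD.
Qed.

Lemma inboxN a x : inbox a (- x) = inbox a x.
Proof. by apply: eq_forallb => i; rewrite ffunE rmorphN normrN. Qed.

Lemma inbox0 a : 0 <= a -> inbox a (0 : Zpt d).
Proof. by move=> a0; apply/inboxP => i; rewrite ffunE normr0 divr_ge0. Qed.

Lemma inbox_ge0 a x : (0 < d)%N -> inbox a x -> 0 <= a.
Proof.
move=> d0 /inboxP/(_ (Ordinal d0))/(le_trans (normr_ge0 _)).
by rewrite pmulr_lge0 ?invr_gt0.
Qed.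

Lemma le_inbox a b x : a <= b -> inbox a x -> inbox b x.
Proof.
move=> ab /inboxP xa; apply/inboxP => i; apply: le_trans (xa i) _.
by rewrite ler_pM2r.
Qed.

Lemma cube_uniq N : uniq (cube d N).
Proof.
rewrite map_inj_uniq ?enum_uniq// => k k' /ffunP kk'.
by apply/ffunP => i; apply/val_inj; have := kk' i; rewrite !ffunE /=; lia.
Qed.

Lemma mem_cube N x : (forall i, (`|x i| <= N)%N) -> x \in cube d N.
Proof.
move=> xN; apply/mapP.
exists [ffun i => inord (absz (x i + N%:Z))]; rewrite ?mem_enum//.
by apply/ffunP => i; rewrite !ffunE; move: (x i) (xN i) => z zN; rewrite inordK; lia.
Qed.

Lemma box_uniq a : uniq (box d a).
Proof. by rewrite filter_uniq// cube_uniq. Qed.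

Lemma mem_box a x : (x \in box d a) = inbox a x.
Proof.
rewrite mem_filter andb_idr// => /inboxP xa; apply: mem_cube => i.
have fl0 : 0 <= Num.floor (`|a| / 2) by rewrite floor_ge0 divr_ge0.
rewrite -lez_nat (gez0_abs fl0) abszE floor_ge_int/= intr_norm.
by rewrite (le_trans (xa i))// ler_pM2r// ler_norm.
Qed.

Lemma sum_box_translate a b y (h : Zpt d -> R) :
  (forall x, h x != 0 -> inbox a (x - y) && inbox b x) ->
  \sum_(x <- box d a) h (x + y) = \sum_(x <- box d b) h x.
Proof.
move=> hab; rewrite -(big_map (fun x => x + y) predT h); apply: perm_big_supp.
apply: uniq_perm => [||x].
- by rewrite filter_uniq// map_inj_uniq ?box_uniq//; exact: addIr.
- by rewrite filter_uniq// box_uniq.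
rewrite [LHS]mem_filter [RHS]mem_filter.
have [//|/hab/andP[xa xb]] := eqVneq (h x) 0; rewrite mem_box xb.
apply/mapP; exists (x - y); rewrite ?subrK//.
by rewrite mem_box.
Qed.

Lemma sum_box_translate_le a y (h : Zpt d -> R) : (forall x, 0 <= h x) ->
  supported a h -> \sum_(x <- box d a) h (x + y) <= \sum_(x <- box d a) h x.
Proof.
move=> h0 ha; pose h' x := if inbox a (x - y) then h x else 0.
have -> : \sum_(x <- box d a) h (x + y) = \sum_(x <- box d a) h' (x + y).
  by rewrite !big_seq; apply: eq_bigr => x; rewrite /h' addrK mem_box => ->.
rewrite (@sum_box_translate a a); first by apply: ler_sum => x _; rewrite /h'; case: ifP.
move=> x; rewrite /h'; case: ifP => [_ /=|_ /eqP//].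
by apply: contraR => /ha ->.
Qed.

Lemma sum_box_neq0 a (h : Zpt d -> R) : h 0 = 0 ->
  \sum_(x <- box d a | x != 0) h x = \sum_(x <- box d a) h x.
Proof. by move=> h0; rewrite big_mkcond; apply: eq_bigr => x _; case: eqVneq => [->|]. Qed.

Definition l1norm x : nat := \sum_(i < d) `|x i|%N.

Lemma l1norm_eq0 x : (l1norm x == 0%N) = (x == 0).
Proof.
rewrite sum_nat_eq0; apply/forallP/eqP => [x0|-> i]; last by rewrite ffunE.
by apply/ffunP => i; have := x0 i; rewrite ffunE absz_eq0 => /eqP.
Qed.

Lemma l1norm_gt0 x : (0 < l1norm x)%N = (x != 0).
Proof. by rewrite lt0n l1norm_eq0. Qed.

Lemma l1normD x y : (l1norm (x + y)%R <= l1norm x + l1norm y)%N.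
Proof.
rewrite -big_split; apply: leq_sum => i _ /=; rewrite ffunE.
by move: (x i) (y i) => m n; lia.
Qed.

Lemma l1normN x : l1norm (- x) = l1norm x.
Proof. by apply: eq_bigr => i _; rewrite ffunE abszN. Qed.

Lemma l1norm_unitv i : l1norm (unitv i) = 1%N.
Proof.
rewrite /l1norm (bigD1 i)//= ffunE eqxx big1// => j ji.
by rewrite ffunE eq_sym (negbTE ji).
Qed.

Lemma l1norm_ge_notin_box a x : ~~ inbox a x -> a / 2 <= (l1norm x)%:R :> R.
Proof.
rewrite negb_forall => /existsP[i]; rewrite -ltNge => /ltW/le_trans; apply.
by rewrite -intr_norm -natr_absz ler_nat /l1norm (bigD1 i)//= leq_addr.
Qed.

Lemma enorm_le_l1norm x : enorm x <= (l1norm x)%:R :> R.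
Proof.
rewrite -[leRHS](ger0_norm (ler0n _ _)) -sqrtr_sqr; apply: ler_wsqrtr.
rewrite natr_sum (eq_bigr (fun i => (`|x i|%N%:R : R) ^+ 2)); first exact: sum_sqr_le_sqr_sum.
by move=> i _; rewrite natr_absz intr_norm real_normK ?num_real.
Qed.

Lemma expR_enorm_le (c : R) x : 0 <= c -> expR (c * enorm x) <= expR c ^+ l1norm x.
Proof. by move=> c0; rewrite -expRM_natr ler_expR ler_wpM2l// enorm_le_l1norm. Qed.

End lattice.

Section geometric_sums.
Context {R : realType} {d : nat}.
Implicit Types (a p : R) (x : Zpt d).

Lemma sum_pow_dist p N :
  (1 - p) * \sum_(j < N.*2.+1) p ^+ `|j%:Z - N%:Z|%N = 1 + p - 2 * p ^+ N.+1.
Proof.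
elim: N => [|N IH]; first by rewrite big_ord1 expr0 expr1; ring.
rewrite doubleS big_ord_recl big_ord_recr/=.
transitivity ((1 - p) * (p ^+ N.+1 +
    (\sum_(j < N.*2.+1) p ^+ `|j%:Z - N%:Z|%N + p ^+ N.+1))).
  congr (_ * (_ + (_ + _))).
  - by congr (_ ^+ _); lia.
  - by apply: eq_bigr => j _; congr (_ ^+ _); rewrite /bump /=; lia.
  - by congr (_ ^+ _); rewrite /bump /=; lia.
by rewrite !(mulrDr (1 - p)) IH (exprS p N.+1); ring.
Qed.

Lemma sum_box_pow_le a p : 0 <= p < 1 ->
  \sum_(x <- box d a) p ^+ l1norm x <= ((1 + p) / (1 - p)) ^+ d.
Proof.
move=> /andP[p0 p1]; set N := `|Num.floor (`|a| / 2)|%N.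
apply: (@le_trans _ _ (\sum_(x <- cube d N) p ^+ l1norm x)).
  rewrite /box big_filter big_mkcond/=; apply: ler_sum => x _.
  by case: ifP => // _; rewrite exprn_ge0.
rewrite /cube big_map big_enum/=.
under eq_bigr => k _.
  rewrite /l1norm -prodrXr; under eq_bigr => i _ do rewrite ffunE.
  over.
rewrite -(bigA_distr_bigA (fun _ (j : 'I_(N.*2.+1)) => p ^+ `|j%:Z - N%:Z|%N)).
rewrite -[X in _ ^+ X]card_ord -prodr_const; apply: ler_prod => i _.
rewrite sumr_ge0 => [/=|j _]; last by rewrite exprn_ge0.
by rewrite ler_pdivlMr ?subr_gt0// mulrC sum_pow_dist gerBl mulr_ge0 ?exprn_ge0.
Qed.

Lemma sum_box_neq0_pow_le a p : 0 <= p <= 2^-1 ->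
  \sum_(x <- box d a | x != 0) p ^+ l1norm x <= 2 * 3 ^+ d * p.
Proof.
move=> /andP[p0 p1].
apply: (@le_trans _ _ (\sum_(x <- box d a) 2 * p * 2^-1 ^+ l1norm x)).
  rewrite big_mkcond/=; apply: ler_sum => x _; case: ifPn => [|_]; last first.
    by rewrite !mulr_ge0 ?exprn_ge0.
  rewrite -l1norm_gt0; case: (l1norm x) => // k _.
  rewrite !exprS mulrACA divff// mul1r.
  by apply: ler_wpM2l => //; apply: lerXn2r; rewrite ?nnegrE.
rewrite -mulr_sumr [leRHS]mulrAC; apply: ler_wpM2l; rewrite ?mulr_ge0//.
have -> : 3 = (1 + 2^-1) / (1 - 2^-1) :> R by field.
by apply: sum_box_pow_le; lra.
Qed.

End geometric_sums.

Section neighbour_sums.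
Context {R : realType} {d : nat}.
Implicit Types (a : R) (x y u : Zpt d) (f g h : Zpt d -> R).

Local Notation deg := ((2 * d)%:R : R).

Definition step (s : 'I_d * bool) : Zpt d := if s.2 then unitv s.1 else - unitv s.1.

Lemma card_steps : #|{: 'I_d * bool}| = (2 * d)%N.
Proof. by rewrite card_prod card_ord card_bool mulnC. Qed.

Lemma l1norm_step s : l1norm (step s) = 1%N.
Proof. by rewrite /step; case: s.2; rewrite ?l1normN l1norm_unitv. Qed.

Lemma l1norm_le_step x s : (l1norm x <= (l1norm (x + step s)%R).+1)%N.
Proof.
by rewrite -addn1 -(l1norm_step s) -[l1norm (step s)]l1normN -[x in leqLHS](addrK (step s)) l1normD.
Qed.

Lemma sum_step_opp (F : Zpt d -> R) : \sum_s F (- step s) = \sum_s F (step s).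
Proof.
rewrite (reindex_inj (h := fun s => (s.1, ~~ s.2))) => [|[i b] [j c] [-> /negb_inj->]//].
by apply: eq_bigr => -[i []] _; rewrite /step/= ?opprK.
Qed.

Definition nbsum f x : R := \sum_s f (x + step s).

Lemma lapE f x : lap f x = nbsum f x - deg * f x.
Proof.
rewrite /nbsum -(pair_bigA _ (fun i b => f (x + step (i, b))))/=.
have -> : deg * f x = \sum_(i < d) (f x + f x).
  by rewrite sumr_const card_ord -mulr2n -mulrnA mulr_natl.
by rewrite -sumrB; apply: eq_bigr => i _; rewrite big_bool /step/=; lra.
Qed.

Lemma nbsum_ge0 f x : (forall y, 0 <= f y) -> 0 <= nbsum f x.
Proof. by move=> f0; exact: sumr_ge0. Qed.

Lemma ler_nbsum f s x : (forall y, 0 <= f y) -> f (x + step s) <= nbsum f x.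
Proof.
by move=> f0; apply: (ler_term_sum (f := fun s => f (x + step s))); rewrite ?mem_index_enum.
Qed.

Lemma nbsum_le_const f x (c : R) : (forall s, f (x + step s) <= c) -> nbsum f x <= deg * c.
Proof. by move=> fc; rewrite -card_steps mulr_natl -sumr_const ler_sum. Qed.

Lemma nbsumBZ f g (c : R) x :
  nbsum (fun y => f y - c * g y) x = nbsum f x - c * nbsum g x.
Proof. by rewrite /nbsum mulr_sumr -sumrB. Qed.

Lemma nbsum_translate f x y : nbsum (fun z => f (z - y)) x = nbsum f (x - y).
Proof. by apply: eq_bigr => s _; rewrite addrAC. Qed.

Lemma sqr_nbsum_le f x : nbsum f x ^+ 2 <= deg * nbsum (fun y => f y ^+ 2) x.
Proof.
have := sqr_sum_le_size (enum {: 'I_d * bool}) (fun s => f (x + step s)).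
by rewrite !big_enum -cardE card_steps.
Qed.

Lemma sum_box_nbsum_le a h : (forall x, 0 <= h x) -> supported a h ->
  \sum_(x <- box d a) nbsum h x <= deg * \sum_(x <- box d a) h x.
Proof.
move=> h0 ha; rewrite exchange_big/= -card_steps mulr_natl -sumr_const.
by apply: ler_sum => s _; exact: sum_box_translate_le.
Qed.

End neighbour_sums.

(** * Schroedinger operators with Dirichlet boundary condition *)

Section dirichlet_operators.
Context {R : realType} {d : nat}.
Implicit Types (a c lam : R) (V f g h : Zpt d -> R) (x y : Zpt d).

Local Notation deg := ((2 * d)%:R : R).

Definition dot a f g := \sum_(x <- box d a) f x * g x.

Definition sqnorm a f := \sum_(x <- box d a) f x ^+ 2.

Lemma sqnorm_ge0 a f : 0 <= sqnorm a f.
Proof. by apply: sumr_ge0 => x _; exact: sqr_ge0. Qed.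

Lemma dotxx a f : dot a f f = sqnorm a f.
Proof. by []. Qed.

Lemma dotC a f g : dot a f g = dot a g f.
Proof. by apply: eq_bigr => x _; rewrite mulrC. Qed.

Lemma dot_ge0 a f g : (forall x, 0 <= f x) -> (forall x, 0 <= g x) -> 0 <= dot a f g.
Proof. by move=> f0 g0; apply: sumr_ge0 => x _; rewrite mulr_ge0. Qed.

Lemma dotBZr a c f g h : dot a h (fun x => f x - c * g x) = dot a h f - c * dot a h g.
Proof. by rewrite /dot mulr_sumr -sumrB; apply: eq_bigr => x _; ring. Qed.

Lemma dotBZl a c f g h : dot a (fun x => f x - c * g x) h = dot a f h - c * dot a g h.
Proof. by rewrite dotC dotBZr !(dotC a h). Qed.

Lemma sqnormBZ a c f g :
  sqnorm a (fun x => f x - c * g x) = sqnorm a f - 2 * c * dot a f g + c ^+ 2 * sqnorm a g.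
Proof. by rewrite -!dotxx dotBZl !dotBZr (dotC a g f); ring. Qed.

Lemma dot_young a c f g : 2 * c * dot a f g <= sqnorm a f + c ^+ 2 * sqnorm a g.
Proof. by have := sqnorm_ge0 a (fun x => f x - c * g x); rewrite sqnormBZ; lra. Qed.

Lemma supportedBZ a c f g : supported a f -> supported a g ->
  supported a (fun x => f x - c * g x).
Proof. by move=> fa ga x xa; rewrite fa// ga// mulr0 subr0. Qed.

Lemma dot_translate a y f g : supported a f -> supported a g ->
  dot a f (fun x => g (x + y)) = dot a (fun x => f (x - y)) g.
Proof.
move=> fa ga; rewrite -[RHS](@sum_box_translate _ _ a a y).
  by apply: eq_bigr => x _; rewrite addrK.
move=> x; rewrite mulf_eq0 negb_or => /andP[fx gx].
by apply/andP; split; [apply: contraR fx => /fa ->|apply: contraR gx => /ga ->].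
Qed.

Lemma dot_nbsum_sym a f g : supported a f -> supported a g ->
  dot a f (nbsum g) = dot a (nbsum f) g.
Proof.
move=> fa ga; transitivity (\sum_s dot a f (fun x => g (x + step s))).
  by rewrite exchange_big; apply: eq_bigr => x _; rewrite mulr_sumr.
under eq_bigr do rewrite dot_translate//.
rewrite (sum_step_opp (fun u => dot a (fun x => f (x + u)) g)).
by rewrite exchange_big; apply: eq_bigr => x _; rewrite mulr_suml.
Qed.

Lemma dot_nbsum_le a f : supported a f -> dot a f (nbsum f) <= deg * sqnorm a f.
Proof.
move=> fa; have sqr_fa : supported a (fun x => f x ^+ 2) by move=> x /fa ->; rewrite expr0n.
have amgm x : f x * nbsum f x <= 2^-1 * (deg * f x ^+ 2 + nbsum (fun y => f y ^+ 2) x).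
  rewrite -card_steps mulr_natl -sumr_const -big_split/= !mulr_sumr; apply: ler_sum => s _.
  by have := sqr_ge0 (f x - f (x + step s)); rewrite sqrrB /=; lra.
have : dot a f (nbsum f) <=
    2^-1 * (deg * sqnorm a f + \sum_(x <- box d a) nbsum (fun y => f y ^+ 2) x).
  by rewrite /sqnorm mulr_sumr -big_split mulr_sumr; apply: ler_sum => x _; exact: amgm.
have := sum_box_nbsum_le (fun x => sqr_ge0 (f x)) sqr_fa; rewrite -/(sqnorm a f); lra.
Qed.

Definition schrodinger V f x := lap f x + V x * f x.

Lemma schrodingerE V f x : schrodinger V f x = nbsum f x + (V x - deg) * f x.
Proof. by rewrite /schrodinger lapE; ring. Qed.

Lemma dot_schrodingerBZ a V c f g h :
  dot a h (schrodinger V (fun x => f x - c * g x)) =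
  dot a h (schrodinger V f) - c * dot a h (schrodinger V g).
Proof.
rewrite -dotBZr; apply: eq_bigr => x _.
by rewrite !schrodingerE nbsumBZ; congr (_ * _); ring.
Qed.

Lemma dot_schrodinger a V f g : dot a f (schrodinger V g) =
  dot a f (nbsum g) + \sum_(x <- box d a) (V x - deg) * (f x * g x).
Proof.
by rewrite -big_split; apply: eq_bigr => x _ /=; rewrite schrodingerE; ring.
Qed.

Lemma dot_schrodinger_sym a V f g : supported a f -> supported a g ->
  dot a f (schrodinger V g) = dot a (schrodinger V f) g.
Proof.
move=> fa ga; rewrite [RHS]dotC !dot_schrodinger dot_nbsum_sym// dotC.
by congr (_ + _); apply: eq_bigr => x _; rewrite (mulrC (f x)).
Qed.

Lemma dot_schrodinger_le a V f c : supported a f ->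
  (forall x, inbox a x -> f x != 0 -> V x <= c) ->
  dot a f (schrodinger V f) <= c * sqnorm a f.
Proof.
move=> fa Vc; rewrite dot_schrodinger.
have : \sum_(x <- box d a) (V x - deg) * (f x * f x) <= (c - deg) * sqnorm a f.
  rewrite mulr_sumr !big_seq; apply: ler_sum => x; rewrite mem_box => xa.
  have [->|fx] := eqVneq (f x) 0; first by rewrite mul0r expr0n !mulr0.
  by rewrite -expr2 ler_wpM2r ?sqr_ge0// lerB// Vc.
have := dot_nbsum_le fa; lra.
Qed.

Definition residual V lam f x := schrodinger V f x - lam * f x.

End dirichlet_operators.

Section ground_states.
Context {R : realType} {d : nat}.
Implicit Types (a lam m : R) (V f g : Zpt d -> R) (x y z : Zpt d).

Local Notation deg := ((2 * d)%:R : R).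

Lemma step_toward a x y : inbox a x -> inbox a y -> y != x ->
  exists s, inbox a (y - step s) /\ (l1norm (y - step s - x)%R < l1norm (y - x)%R)%N.
Proof.
move=> /inboxP xa /inboxP ya yx.
have [i yxi] : exists i, y i != x i.
  by apply/existsP; apply: contraR yx; rewrite negb_exists => /forallP e;
     apply/eqP/ffunP => i; apply/eqP; rewrite -[_ == _]negbK e.
pose s := (i, x i < y i); exists s.
have zi : (y - step s) i = if x i < y i then y i - 1 else y i + 1.
  by rewrite /step/=; case: ifP => _; rewrite !ffunE eqxx ?opprK.
have zj j : j != i -> (y - step s) j = y j.
  by move=> ji; rewrite /step; case: ifP => _; rewrite !ffunE/= [i == j]eq_sym (negbTE ji) subr0.
move: (y - step s) zi zj => z zi zj.
split.
  apply/inboxP => j; have [->|/zj ->//] := eqVneq j i.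
  have : (`|z i| <= maxn `|x i| `|y i|)%N.
    by rewrite zi; move: (x i) (y i) yxi => u w; case: ifP; lia.
  rewrite -intr_norm -natr_absz leq_max => /orP[] le_zi.
    by apply: le_trans (xa i); rewrite -intr_norm -natr_absz ler_nat.
  by apply: le_trans (ya i); rewrite -intr_norm -natr_absz ler_nat.
rewrite /l1norm (bigD1 i)//= [ltnRHS](bigD1 i)//= -addSn leq_add//.
  by rewrite !ffunE zi; move: (x i) (y i) yxi => u w; case: ifP; lia.
by apply: leq_sum => j ji; rewrite !ffunE zj.
Qed.

Lemma eigen_supported a V lam f : dirichlet_eigen a V lam f -> supported a f.
Proof. by case. Qed.

Lemma eigen_nbsum a V lam f x : dirichlet_eigen a V lam f -> inbox a x ->
  nbsum f x = (lam + deg - V x) * f x.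
Proof. by move=> [_ _ eq] /eq; rewrite lapE; lra. Qed.

Lemma eigen_dotr a V lam f g : dirichlet_eigen a V lam f ->
  dot a g (schrodinger V f) = lam * dot a g f.
Proof.
move=> [_ _ eq]; rewrite mulr_sumr; rewrite /dot !big_seq; apply: eq_bigr => x.
by rewrite mem_box => xa; rewrite /schrodinger eq// mulrCA.
Qed.

Lemma eigen_dotl a V lam f g : dirichlet_eigen a V lam f -> supported a g ->
  dot a f (schrodinger V g) = lam * dot a f g.
Proof.
move=> eig ga; rewrite dot_schrodinger_sym//; last exact: eigen_supported eig.
by rewrite dotC (eigen_dotr _ eig) dotC.
Qed.

Lemma eigen_gt0 a V lam f x : dirichlet_eigen a V lam f ->
  (forall y, 0 <= f y) -> inbox a x -> 0 < f x.
Proof.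
move=> eig f0 xa; rewrite lt_neqAle f0 andbT; apply/negP => /eqP fx0.
have vanish k y : inbox a y -> (l1norm (y - x)%R <= k)%N -> f y = 0.
  elim: k y => [|k IH] y ya.
    by rewrite leqn0 l1norm_eq0 subr_eq0 => /eqP ->.
  move=> yk; have [->//|yx] := eqVneq y x.
  have [s [za zx]] := step_toward xa ya yx.
  apply/eqP; rewrite eq_le f0 andbT -[y in f y](subrK (step s)).
  apply: le_trans (ler_nbsum s (y - step s) f0) _.
  by rewrite (eigen_nbsum eig za) IH ?mulr0// -ltnS (leq_trans zx).
have [out [y /eqP fy] _] := eig; apply: fy.
by have [ya|/out//] := boolP (inbox a y); exact: vanish (leqnn _).
Qed.

Lemma eigen_ge a V lam f x : dirichlet_eigen a V lam f ->
  (forall y, 0 <= f y) -> inbox a x -> V x - deg <= lam.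
Proof.
move=> eig f0 xa; have fx0 := eigen_gt0 eig f0 xa.
by have := nbsum_ge0 x f0; rewrite (eigen_nbsum eig xa) pmulr_lge0//; lra.
Qed.

Lemma eigen_le a V lam f c : dirichlet_eigen a V lam f -> sqnorm a f = 1 ->
  (forall x, inbox a x -> V x <= c) -> lam <= c.
Proof.
move=> eig f1 Vc; rewrite -[lam]mulr1 -[c]mulr1 -f1 -{1}dotxx -(eigen_dotr _ eig).
by apply: dot_schrodinger_le => [|x xa _]; [exact: eigen_supported eig|exact: Vc].
Qed.

Definition well_at a V m x0 := forall x, inbox a x -> x != x0 -> V x <= V x0 - m.

Lemma eigen_nbsum_ge a V lam f x0 m : dirichlet_eigen a V lam f ->
  (forall x, 0 <= f x) -> inbox a x0 -> well_at a V m x0 ->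
  forall x, x != x0 -> m * f x <= nbsum f x.
Proof.
move=> eig f0 x0a Vm x xx0; have [xa|xa] := boolP (inbox a x); last first.
  by rewrite (eigen_supported eig)// mulr0 nbsum_ge0.
rewrite (eigen_nbsum eig xa) ler_wpM2r//.
by have := eigen_ge eig f0 x0a; have := Vm _ xa xx0; lra.
Qed.

Lemma ground_state_decay a f m : 0 < m -> (forall x, 0 <= f x) -> supported a f ->
  sqnorm a f = 1 -> (forall x, x != 0 -> m * f x <= nbsum f x) ->
  forall x, f x <= (deg / m) ^+ l1norm x.
Proof.
move=> m0 f0 fa f1 fm x.
suff decay k y : (k <= l1norm y)%N -> f y <= (deg / m) ^+ k by exact: decay.
elim: k y => [|k IH] y ky.
  have [ya|/fa ->//] := boolP (inbox a y).
  rewrite expr0 -(@ler_pXn2r _ 2) ?nnegrE// expr1n -f1.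
  by apply: (ler_term_sum (f := fun z => f z ^+ 2)) => [z|]; rewrite ?sqr_ge0 ?mem_box.
have y0 : y != 0 by rewrite -l1norm_gt0 (leq_trans _ ky).
rewrite exprS mulrAC ler_pdivlMr// mulrC (le_trans (fm _ y0))//.
apply: nbsum_le_const => s; apply: IH; rewrite -ltnS (leq_trans ky)//.
exact: l1norm_le_step.
Qed.

End ground_states.

(** * Perturbation of the principal eigenpair *)

Section spectral_gap.
Context {R : realType} {d : nat}.
Variables (a lam lam2 : R) (V phi : Zpt d -> R) (x0 : Zpt d).
Hypotheses (eig : dirichlet_eigen a V lam phi) (phi1 : sqnorm a phi = 1).
Hypotheses (phix0 : phi x0 != 0) (le_lam : lam2 <= lam).
Hypothesis form_le : forall g, supported a g -> g x0 = 0 ->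
  dot a g (schrodinger V g) <= lam2 * sqnorm a g.

Let phia : supported a phi := eigen_supported eig.

(* The multiple of [phi] added to [w] to make it vanish at [x0] leaves the
   form of [schrodinger V - lam] unchanged and can only increase the norm. *)
Lemma dot_schrodinger_orthogonal_le w : supported a w -> dot a w phi = 0 ->
  dot a w (schrodinger V w) <= lam2 * sqnorm a w.
Proof.
move=> wa w_phi; pose c := w x0 / phi x0; pose g x := w x - c * phi x.
have ga : supported a g by exact: supportedBZ.
have gx0 : g x0 = 0 by rewrite /g /c divfK ?subrr.
have norm_g : sqnorm a g = sqnorm a w + c ^+ 2.
  by rewrite sqnormBZ w_phi phi1; ring.
have form_g : dot a g (schrodinger V g) = dot a w (schrodinger V w) + lam * c ^+ 2.
  rewrite dot_schrodingerBZ (eigen_dotr _ eig) !dotBZl (eigen_dotl eig wa).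
  by rewrite (dotC _ phi w) w_phi dotxx phi1; ring.
have : lam2 * c ^+ 2 <= lam * c ^+ 2 by rewrite ler_wpM2r ?sqr_ge0.
by have := form_le ga gx0; rewrite norm_g form_g; lra.
Qed.

Variables (mu : R) (psi : Zpt d -> R).
Hypotheses (psia : supported a psi) (psi1 : sqnorm a psi = 1).
Hypotheses (psi_phi : 0 <= dot a psi phi) (gap : lam2 < mu).

Local Notation rho := (residual V mu psi).
Local Notation p := (dot a psi phi).
Local Notation w := (fun x => psi x - p * phi x).

Let w_supported : supported a w. Proof. exact: supportedBZ. Qed.

Let w_phi : dot a w phi = 0.
Proof. by rewrite dotBZl dotxx phi1 mulr1 subrr. Qed.

Let sqnorm_w : sqnorm a w = 1 - p ^+ 2.
Proof. by rewrite sqnormBZ psi1 phi1; ring. Qed.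

Let w_form : dot a w (schrodinger V w) = dot a w rho + mu * sqnorm a w.
Proof.
rewrite dot_schrodingerBZ (eigen_dotr _ eig) w_phi dotBZr sqnorm_w.
by rewrite (dotBZl _ _ _ _ psi) dotxx psi1 (dotC _ phi); ring.
Qed.

Let gap_w : (mu - lam2) * sqnorm a w <= - dot a w rho.
Proof. by have := dot_schrodinger_orthogonal_le w_supported w_phi; rewrite w_form; lra. Qed.

Let sqr_gap_w : (mu - lam2) ^+ 2 * sqnorm a w <= sqnorm a rho.
Proof.
have := dot_young a (lam2 - mu) rho w; rewrite dotC.
have : (mu - lam2) * ((mu - lam2) * sqnorm a w) <= (mu - lam2) * - dot a w rho.
  by rewrite ler_pM2l ?subr_gt0//; exact: gap_w.
lra.
Qed.

Lemma eigenvector_perturbation :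
  (mu - lam2) ^+ 2 * sqnorm a (fun x => phi x - psi x) <= 2 * sqnorm a rho.
Proof.
have -> : sqnorm a (fun x => phi x - psi x) = 2 - 2 * p.
  rewrite (_ : (fun x => _) = (fun x => phi x - 1 * psi x)); last first.
    by apply/funext => x; rewrite mul1r.
  by rewrite sqnormBZ phi1 psi1 dotC; ring.
have p1 : p <= 1 by rewrite -(@expr_le1 _ 2)//; have := sqnorm_ge0 a w; rewrite sqnorm_w; lra.
have p2 : p ^+ 2 <= p by rewrite expr2 ler_piMl.
have := sqr_gap_w; rewrite sqnorm_w.
have : (mu - lam2) ^+ 2 * (2 - 2 * p) <= (mu - lam2) ^+ 2 * (2 * (1 - p ^+ 2)).
  by apply: ler_wpM2l; [exact: sqr_ge0|lra].
lra.
Qed.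

Lemma eigenvalue_perturbation : lam - mu <= mu - lam2 ->
  (mu - lam2) * `|lam - mu - dot a rho psi| <= 2 * sqnorm a rho.
Proof.
move=> lam_mu.
have -> : lam - mu - dot a rho psi = lam * sqnorm a w - dot a w (schrodinger V w).
  have -> : dot a rho psi = dot a w rho + p * dot a phi rho.
    by rewrite dotBZl !(dotC _ _ rho); ring.
  have -> : dot a phi rho = (lam - mu) * p.
    by rewrite dotBZr (eigen_dotl eig psia) (dotC _ phi); ring.
  by rewrite w_form sqnorm_w; ring.
have w0 := sqnorm_ge0 a w; have g0 : 0 < mu - lam2 by rewrite subr_gt0.
rewrite ger0_norm.
  have := dot_young a (lam2 - mu) rho w; rewrite dotC w_form.
  have : (mu - lam2) * ((lam - mu) * sqnorm a w) <= (mu - lam2) * ((mu - lam2) * sqnorm a w).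
    by rewrite ler_pM2l// ler_wpM2r.
  have := sqr_gap_w; lra.
have := dot_schrodinger_orthogonal_le w_supported w_phi.
have : lam2 * sqnorm a w <= lam * sqnorm a w by rewrite ler_wpM2r.
lra.
Qed.

End spectral_gap.

Section potential_well.
Context {R : realType} {d : nat}.
Variables (a m lam mu : R) (V phi psi : Zpt d -> R) (x0 : Zpt d).

Local Notation deg := ((2 * d)%:R : R).

Hypotheses (m0 : 0 < m) (deep : 2 * deg <= m) (x0a : inbox a x0) (well : well_at a V m x0).
Hypothesis phiP : principal_eigenpair a V lam phi.
Hypotheses (psi0 : forall x, 0 <= psi x) (psia : supported a psi) (psi1 : sqnorm a psi = 1).
Hypothesis mu_ge : V x0 - deg <= mu.

Local Notation lam2 := (V x0 - m).

Let eig : dirichlet_eigen a V lam phi. Proof. by case: phiP. Qed.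
Let phi0 x : 0 <= phi x. Proof. by case: phiP. Qed.
Let phi1 : sqnorm a phi = 1. Proof. by case: phiP. Qed.

Let phix0 : phi x0 != 0. Proof. by rewrite gt_eqF// (eigen_gt0 eig). Qed.

Let lam_ge : lam2 <= lam.
Proof. by have := eigen_ge eig phi0 x0a; have := deep; have := ler0n R (2 * d); lra. Qed.

Let lam_le : lam <= V x0.
Proof.
apply: (eigen_le eig phi1) => x xa; have [->//|xx0] := eqVneq x x0.
by have := well xa xx0; have := m0; lra.
Qed.

Let form_le g : supported a g -> g x0 = 0 ->
  dot a g (schrodinger V g) <= lam2 * sqnorm a g.
Proof.
move=> ga gx0; apply: dot_schrodinger_le => // x xa gx; apply: well => //.
by apply: contraNneq gx => ->; rewrite gx0.
Qed.

Let psi_phi : 0 <= dot a psi phi. Proof. exact: dot_ge0. Qed.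

Let half_gap : m / 2 <= mu - lam2.
Proof. by have := mu_ge; have := deep; have := ler0n R (2 * d); lra. Qed.

Let gap : lam2 < mu. Proof. by have := half_gap; have := m0; lra. Qed.

Lemma well_eigenvalue_perturbation :
  m * `|lam - mu - dot a (residual V mu psi) psi| <= 4 * sqnorm a (residual V mu psi).
Proof.
have lam_mu : lam - mu <= mu - lam2.
  by have := lam_le; have := mu_ge; have := deep; have := ler0n R (2 * d); lra.
have := eigenvalue_perturbation eig phi1 phix0 lam_ge form_le psia psi1 gap lam_mu.
by move=> /(le_trans (ler_wpM2r (normr_ge0 _) half_gap)); lra.
Qed.

Lemma well_eigenvector_perturbation :
  m ^+ 2 * sqnorm a (fun x => phi x - psi x) <= 8 * sqnorm a (residual V mu psi).
Proof.
have := eigenvector_perturbation eig phi1 phix0 lam_ge form_le psia psi1 psi_phi gap.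
have half_m0 : 0 <= m / 2 by rewrite divr_ge0// ltW.
have sqr_half_gap : (m / 2) ^+ 2 <= (mu - lam2) ^+ 2.
  by apply: lerXn2r half_gap; rewrite nnegrE// (le_trans half_m0).
by move=> /(le_trans (ler_wpM2r (sqnorm_ge0 _ _) sqr_half_gap)); rewrite expr_div_n; lra.
Qed.

End potential_well.

Section transplantation.
Context {R : realType} {d : nat}.
Variables (r RR lbar : R) (Vb V phibar : Zpt d -> R) (x0 : Zpt d).

Local Notation deg := ((2 * d)%:R : R).

Hypotheses (r0 : 0 < r) (box_sub : forall y, inbox r y -> inbox RR (y + x0)).
Hypothesis eigbar : dirichlet_eigen r Vb lbar phibar.

Definition transplant x : R := phibar (x - x0).

Definition potential_error y : R := V (y + x0) - V x0 - Vb y.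

Local Notation psi := transplant.
Local Notation W := potential_error.
Local Notation rho := (residual V (lbar + V x0) psi).

Let bar_out : supported r phibar. Proof. exact: eigen_supported eigbar. Qed.

Lemma sum_transplant (h : Zpt d -> R) : supported r h ->
  \sum_(x <- box d RR) h (x - x0) = \sum_(y <- box d r) h y.
Proof.
move=> hr; apply: sum_box_translate => y hy; have yr : inbox r y.
  by apply: contraR hy => /hr ->.
by rewrite opprK yr box_sub.
Qed.

Lemma transplant_supported : supported RR psi.
Proof.
by move=> x xR; apply: bar_out; apply: contra xR => /box_sub; rewrite subrK.
Qed.

Lemma sqnorm_transplant : sqnorm RR psi = sqnorm r phibar.
Proof.
by apply: (sum_transplant (h := fun x => phibar x ^+ 2)) => y /bar_out ->; rewrite expr0n.
Qed.

Lemma residual_transplant_in x : inbox r (x - x0) ->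
  rho x = W (x - x0) * phibar (x - x0).
Proof.
move=> xr; rewrite /residual schrodingerE nbsum_translate (eigen_nbsum eigbar xr).
by rewrite /W subrK /psi; ring.
Qed.

Lemma residual_transplant_out x : ~~ inbox r (x - x0) -> rho x = nbsum phibar (x - x0).
Proof.
move=> xr; rewrite /residual schrodingerE nbsum_translate /psi bar_out//; ring.
Qed.

Lemma dot_residual_transplant :
  dot RR rho psi = \sum_(y <- box d r) W y * phibar y ^+ 2.
Proof.
rewrite -sum_transplant => [|y /bar_out ->]; last by rewrite expr0n mulr0.
apply: eq_bigr => x _; have [xr|xr] := boolP (inbox r (x - x0)).
  by rewrite residual_transplant_in// expr2 mulrA.
by rewrite /psi bar_out// expr0n !mulr0.
Qed.

Local Notation weighted := (fun y => (l1norm y).+1%:R * phibar y ^+ 2).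

(* Neighbours of a point outside the box have l1-norm at least [r / 2 - 1]. *)
Lemma sqr_nbsum_out_le y : ~~ inbox r y ->
  nbsum phibar y ^+ 2 <= deg * (2 / r) * nbsum weighted y.
Proof.
move=> yr; apply: le_trans (sqr_nbsum_le _ _) _.
rewrite -(mulrA deg) ler_wpM2l// mulr_sumr; apply: ler_sum => s _.
rewrite mulrA ler_peMl ?sqr_ge0// mulrAC ler_pdivlMr// mul1r.
have : (l1norm y)%:R <= (l1norm (y + step s)).+1%:R :> R by rewrite ler_nat l1norm_le_step.
by have := l1norm_ge_notin_box yr; lra.
Qed.

Lemma sqnorm_residual_transplant_le :
  sqnorm RR rho <= \sum_(y <- box d r) W y ^+ 2 * phibar y ^+ 2 +
    deg ^+ 2 * (2 / r) * \sum_(y <- box d r) weighted y.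
Proof.
have weighted0 y : 0 <= weighted y by rewrite mulr_ge0 ?sqr_ge0.
have weighted_out : supported r weighted by move=> y /bar_out ->; rewrite expr0n mulr0.
have C0 : 0 <= deg * (2 / r) by rewrite mulr_ge0// divr_ge0// ltW.
have bound x : rho x ^+ 2 <= W (x - x0) ^+ 2 * phibar (x - x0) ^+ 2 +
    deg * (2 / r) * nbsum (fun z => weighted (z - x0)) x.
  rewrite (nbsum_translate weighted); have [xr|xr] := boolP (inbox r (x - x0)).
    by rewrite residual_transplant_in// exprMn lerDl mulr_ge0 ?nbsum_ge0.
  by rewrite residual_transplant_out// bar_out// expr0n mulr0 add0r sqr_nbsum_out_le.
apply: le_trans (ler_sum _ (fun x _ => bound x)) _; rewrite big_split/=.
rewrite (sum_transplant (h := fun y => W y ^+ 2 * phibar y ^+ 2)); last first.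
  by move=> y /bar_out ->; rewrite expr0n mulr0.
rewrite lerD2l -mulr_sumr -(sum_transplant weighted_out).
have -> : deg ^+ 2 * (2 / r) = deg * (2 / r) * deg by ring.
rewrite -[leRHS]mulrA ler_wpM2l// sum_box_nbsum_le// => x xR.
by apply: weighted_out; apply: contra xR => /box_sub; rewrite subrK.
Qed.

End transplantation.

Section weighted_mass.
Context {R : realType} {d : nat}.
Variables (a q : R) (f : Zpt d -> R).
Hypotheses (q0 : 0 <= q) (f0 : forall x, 0 <= f x) (decay : forall x, f x <= q ^+ l1norm x).

Lemma weighted_mass_le (A p : R) (g : Zpt d -> R) : 0 <= A -> 0 <= p -> p * q ^+ 2 <= 2^-1 ->
  (forall x, inbox a x -> x != 0 -> g x <= A * p ^+ l1norm x) ->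
  \sum_(x <- box d a | x != 0) g x * f x ^+ 2 <= A * (2 * 3 ^+ d * (p * q ^+ 2)).
Proof.
move=> A0 p0 pq gA.
apply: (@le_trans _ _ (A * \sum_(x <- box d a | x != 0) (p * q ^+ 2) ^+ l1norm x)).
  rewrite mulr_sumr big_seq_cond [leRHS]big_seq_cond; apply: ler_sum => x.
  rewrite mem_box => /andP[xa x0]; rewrite (exprMn (l1norm x)) [leRHS]mulrA.
  apply: (@le_trans _ _ (A * p ^+ l1norm x * f x ^+ 2)).
    by rewrite ler_wpM2r ?sqr_ge0// gA.
  rewrite ler_wpM2l ?mulr_ge0 ?exprn_ge0// exprAC lerXn2r ?nnegrE ?exprn_ge0//.
by rewrite ler_wpM2l// sum_box_neq0_pow_le// pq mulr_ge0// sqr_ge0.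
Qed.

End weighted_mass.

(** * Localisation at a high point of the field *)

Section covariance.
Context {R : realType} {d : nat}.
Implicit Types (x y : Zpt d).

Definition covariance_bounds (c c' D : R) (v : Zpt d -> R) :=
  forall x, x != 0 -> 1 - expR (c' * enorm x) / D <= v x <= 1 - c / D.

Variables (c c' D : R) (v : Zpt d -> R).
Hypotheses (c0 : 0 < c) (c'0 : 0 <= c') (D0 : 0 < D).
Hypothesis v_bounds : covariance_bounds c c' D v.

Lemma one_sub_cov_ge x : x != 0 -> c / D <= 1 - v x.
Proof. by move=> /v_bounds/andP[_]; lra. Qed.

Lemma one_sub_cov_le x : x != 0 -> 1 - v x <= D^-1 * expR c' ^+ l1norm x.
Proof.
move=> /v_bounds/andP[vx _].
have : D^-1 * expR (c' * enorm x) <= D^-1 * expR c' ^+ l1norm x.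
  by rewrite ler_wpM2l ?invr_ge0 ?(ltW D0)// expR_enorm_le.
by lra.
Qed.

Lemma covM_lt1 y : (forall x, 0 <= v x) -> y != 0 -> v y * v (- y) < 1.
Proof.
move=> v_ge0 y0; have yN0 : - y != 0 by rewrite oppr_eq0.
have := one_sub_cov_ge y0; have := one_sub_cov_ge yN0; have : 0 < c / D by rewrite divr_gt0.
by have := v_ge0 y; have := v_ge0 (- y); move: (v y) (v (- y)) => s t; nra.
Qed.

Lemma one_sub_covM_le y : (forall x, 0 <= v x) -> y != 0 ->
  1 - v y * v (- y) <= 2 / D * expR c' ^+ l1norm y.
Proof.
move=> v_ge0 y0; have yN0 : - y != 0 by rewrite oppr_eq0.
have := one_sub_cov_le y0; have := one_sub_cov_le yN0; rewrite l1normN.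
have := one_sub_cov_ge y0; have := one_sub_cov_ge yN0; have : 0 < c / D by rewrite divr_gt0.
by have := v_ge0 y; have := v_ge0 (- y); move: (v y) (v (- y)) => s t; nra.
Qed.

End covariance.

Section constants.
Context {R : realType}.
Variables (d : nat) (c c' : R).

Local Notation deg := ((2 * d)%:R : R).
Local Notation theta := ((2 * d + 1)%:R : R).
Local Notation geo := (2 * 3 ^+ d : R).
Local Notation b := (expR c').

Definition decay_const : R := 2 * deg / c.

Local Notation K := decay_const.

(* If [a / D] exceeds the first term then [xi x0 >= 2 a / 3] on the event; if it
   exceeds the second then all the geometric series below have ratio at most [1 / 2]. *)
Definition ratio_threshold : R := 3 * theta + 2 * (b * K + 1) ^+ 2.

Definition zeta_const : R := 4 * geo * b * K ^+ 2.

Definition height_const : R := theta * geo * b * K ^+ 2.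

Definition residual_const : R :=
  zeta_const + 2 * (theta * b) * height_const + 2 * deg ^+ 2 * (1 + geo).

(* The depth of the well is [m = c / (2 eps)]; the eigenvalue error is
   [4 / m * residual_const + height_const * eps] and the eigenvector error
   [sqrt (8 * residual_const) / m]; adding [1] lets one constant serve both. *)
Definition error_const : R := 8 / c * (residual_const + 1) + height_const.

Hypothesis c0 : 0 < c.

Lemma decay_const_ge0 : 0 <= K.
Proof. by rewrite divr_ge0 ?mulr_ge0// ltW. Qed.

Lemma ratio_threshold_ge2 : 2 <= ratio_threshold.
Proof.
have : 1 <= theta by rewrite ler1n addn1.
by rewrite /ratio_threshold; have := sqr_ge0 (b * K + 1); lra.
Qed.

Let geo0 : 0 <= geo. Proof. by rewrite mulr_ge0 ?exprn_ge0. Qed.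

Lemma zeta_const_ge0 : 0 <= zeta_const.
Proof. by rewrite mulr_ge0 ?sqr_ge0// mulr_ge0 ?expR_ge0// mulr_ge0. Qed.

Lemma height_const_ge0 : 0 <= height_const.
Proof. by rewrite mulr_ge0 ?sqr_ge0// mulr_ge0 ?expR_ge0// mulr_ge0. Qed.

Lemma residual_const_ge0 : 0 <= residual_const.
Proof.
apply: addr_ge0; last by rewrite mulr_ge0 ?addr_ge0// mulr_ge0 ?sqr_ge0.
by rewrite addr_ge0 ?zeta_const_ge0// mulr_ge0 ?height_const_ge0// !mulr_ge0 ?expR_ge0.
Qed.

Lemma error_const_gt0 : 0 < error_const.
Proof.
rewrite ltr_wpDr ?height_const_ge0// mulr_gt0 ?divr_gt0//.
by rewrite ltr_wpDl ?residual_const_ge0.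
Qed.

End constants.

Section localisation.
Context {R : realType} {d : nat}.
Variables (c c' a D r : R) (v : Zpt d -> R).

Local Notation deg := ((2 * d)%:R : R).
Local Notation theta := ((2 * d + 1)%:R : R).
Local Notation geo := (2 * 3 ^+ d : R).
Local Notation b := (expR c').
Local Notation K := (decay_const d c).
Local Notation eps := (D / a).
Local Notation zeta_const := (zeta_const d c c').
Local Notation height_const := (height_const d c c').
Local Notation residual_const := (residual_const d c c').
Local Notation error_const := (error_const d c c').

Hypotheses (c0 : 0 < c) (c'0 : 0 <= c').
Hypotheses (D1 : 1 <= D) (Da : ratio_threshold d c c' * D <= a) (ar : a <= r).
Hypothesis v0 : v 0 = 1.
Hypothesis v_bounds : covariance_bounds c c' D v.

Let D0 : 0 < D. Proof. exact: lt_le_trans D1. Qed.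
Let b1 : 1 <= b. Proof. by rewrite -[leLHS]expR0 ler_expR. Qed.
Let b0 : 0 <= b. Proof. exact: expR_ge0. Qed.
Let K0 : 0 <= K. Proof. exact: decay_const_ge0. Qed.
Let bK0 : 0 <= b * K. Proof. exact: mulr_ge0. Qed.
Let geo0 : 0 <= geo. Proof. by rewrite mulr_ge0 ?exprn_ge0. Qed.
Let theta1 : 1 <= theta. Proof. by rewrite ler1n addn1. Qed.

Let theta_le : 3 * theta <= a.
Proof.
apply: le_trans Da; rewrite -[leLHS]mulr1; apply: ler_pM => //.
by rewrite /ratio_threshold lerDl mulr_ge0 ?sqr_ge0.
Qed.

Let a1 : 1 <= a. Proof. by have := theta_le; have := theta1; lra. Qed.
Let a0 : 0 < a. Proof. exact: lt_le_trans a1. Qed.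
Let r0 : 0 < r. Proof. exact: lt_le_trans ar. Qed.
Let eps0 : 0 < eps. Proof. exact: divr_gt0. Qed.

Let eps_small : (b * K + 1) ^+ 2 * eps <= 2^-1.
Proof.
have le_a : 2 * (b * K + 1) ^+ 2 * D <= a.
  by apply: le_trans Da; rewrite ler_pM2r// lerDr mulr_ge0.
by rewrite [leLHS]mulrA ler_pdivrMr//; lra.
Qed.

(* Half of [a * c / D]: the fluctuations of [xi x0] and [zeta] cost at most the rest. *)
Definition well_depth : R := a / 2 * (c / D).

Definition decay_rate : R := K * eps.

Local Notation m := well_depth.
Local Notation q := decay_rate.

Lemma well_depth_gt0 : 0 < m.
Proof. by rewrite mulr_gt0 ?divr_gt0. Qed.

Lemma decay_rateE : deg / m = q.
Proof. by rewrite /m /q /decay_const; field; rewrite !gt_eqF. Qed.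

Let q0 : 0 <= q. Proof. by rewrite mulr_ge0// ltW. Qed.

Let eps1 : eps <= 1.
Proof.
have : 1 * eps <= (b * K + 1) ^+ 2 * eps by rewrite ler_wpM2r ?(ltW eps0)// exprn_ege1// lerDr.
by have := eps_small; lra.
Qed.

Let q_half : q <= 2^-1.
Proof.
apply: le_trans eps_small; rewrite ler_wpM2r ?(ltW eps0)//.
have : 1 * K <= b * K by rewrite ler_wpM2r.
have : 1 * (b * K + 1) <= (b * K + 1) * (b * K + 1) by rewrite ler_wpM2r ?lerDr// addr_ge0.
by rewrite expr2; lra.
Qed.

Let deep : 2 * deg <= m.
Proof. by have := q_half; rewrite -decay_rateE ler_pdivrMr ?well_depth_gt0//; lra. Qed.

Let bK2_eps : b ^+ 2 * K ^+ 2 * eps <= 2^-1.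
Proof.
apply: le_trans eps_small; rewrite ler_wpM2r ?(ltW eps0)// -exprMn.
by rewrite lerXn2r ?nnegrE ?addr_ge0// lerDl.
Qed.

Let b2_q2 : b ^+ 2 * q ^+ 2 <= 2^-1.
Proof.
have -> : b ^+ 2 * q ^+ 2 = b ^+ 2 * K ^+ 2 * eps * eps by rewrite /q; ring.
by apply: le_trans bK2_eps; rewrite ler_piMr// mulr_ge0 ?(ltW eps0)// mulr_ge0 ?sqr_ge0.
Qed.

Let b_q2 : b * q ^+ 2 <= 2^-1.
Proof. by apply: le_trans b2_q2; rewrite ler_wpM2r ?sqr_ge0// expr2 ler_peMl. Qed.

Let q2 : 2 * q ^+ 2 <= 2^-1.
Proof.
have : q ^+ 2 <= 2^-1 ^+ 2 by apply: lerXn2r q_half; rewrite nnegrE// invr_ge0.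
by lra.
Qed.

Lemma one_sub_cov_ge0 x : 0 <= 1 - v x.
Proof.
have [->|/(one_sub_cov_ge v_bounds)] := eqVneq x 0; first by rewrite v0 subrr.
by apply: le_trans; rewrite divr_ge0// ltW.
Qed.

Local Notation barV := (fun x => - (a * (1 - v x))).

Lemma covariance_well : well_at r barV m 0.
Proof.
move=> x _ x0; rewrite v0 subrr mulr0 oppr0 sub0r lerN2.
apply: (@le_trans _ _ (a * (c / D))); last by rewrite ler_pM2l// (one_sub_cov_ge v_bounds).
by rewrite ler_wpM2r ?divr_ge0 ?(ltW c0) ?(ltW D0)//; have := a0; lra.
Qed.

Variables (lbar : R) (phibar : Zpt d -> R).
Hypothesis barP : principal_eigenpair r barV lbar phibar.

Let bar_eig : dirichlet_eigen r barV lbar phibar. Proof. by case: barP. Qed.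
Let bar_ge0 x : 0 <= phibar x. Proof. by case: barP. Qed.
Let bar_supported : supported r phibar. Proof. exact: eigen_supported bar_eig. Qed.
Let bar_norm : sqnorm r phibar = 1. Proof. by case: barP. Qed.
Let box0 : inbox r (0 : Zpt d). Proof. by rewrite inbox0// ltW. Qed.

Lemma lbar_ge : - deg <= lbar.
Proof.
by have := eigen_ge bar_eig bar_ge0 box0; rewrite v0 subrr mulr0 oppr0 sub0r.
Qed.

Lemma phibar_decay x : phibar x <= q ^+ l1norm x.
Proof.
rewrite -decay_rateE; apply: (ground_state_decay (a := r)) => // [|y y0].
  exact: well_depth_gt0.
exact: (eigen_nbsum_ge bar_eig bar_ge0 box0 covariance_well).
Qed.

Lemma one_sub_cov_mass :
  \sum_(x <- box d r) (1 - v x) * phibar x ^+ 2 <= D^-1 * (geo * (b * q ^+ 2)).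
Proof.
rewrite -sum_box_neq0; last by rewrite v0 subrr mul0r.
apply: (weighted_mass_le q0 bar_ge0 phibar_decay _ b0 b_q2) => [|x _].
  by rewrite invr_ge0 ltW.
exact: (one_sub_cov_le c'0 D0 v_bounds).
Qed.

Lemma sqr_one_sub_cov_mass :
  \sum_(x <- box d r) (1 - v x) ^+ 2 * phibar x ^+ 2 <=
  D^-1 ^+ 2 * (geo * (b ^+ 2 * q ^+ 2)).
Proof.
rewrite -sum_box_neq0; last by rewrite v0 subrr expr0n mul0r.
apply: (weighted_mass_le q0 bar_ge0 phibar_decay _ _ b2_q2); rewrite ?sqr_ge0// => x _ x0.
rewrite exprAC -exprMn.
apply: lerXn2r (one_sub_cov_le c'0 D0 v_bounds x0); rewrite nnegrE ?one_sub_cov_ge0//.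
by rewrite mulr_ge0 ?invr_ge0 ?exprn_ge0// ltW.
Qed.

Lemma l1norm_mass : \sum_(x <- box d r) (l1norm x).+1%:R * phibar x ^+ 2 <= 1 + geo.
Proof.
rewrite (bigD1_seq 0) ?mem_box ?box_uniq//= lerD//.
  rewrite (_ : l1norm 0 = 0%N) ?mul1r; last by apply/eqP; rewrite l1norm_eq0.
  rewrite -bar_norm; apply: (ler_term_sum (f := fun x => phibar x ^+ 2)) => [x|].
    exact: sqr_ge0.
  by rewrite mem_box.
apply: le_trans (weighted_mass_le q0 bar_ge0 phibar_decay (A := 1) (p := 2) _ _ q2 _) _ => //.
  by move=> x _ _; rewrite mul1r -natrX ler_nat ltn_expl.
by rewrite mul1r ler_piMr//; have := q2; lra.
Qed.

Variables (T : Type) (xi : Zpt d -> T -> R) (w : T) (x0 : Zpt d) (RR eta : R).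

Local Notation field := (fun x => xi x w).
Local Notation s := (xi x0 w - a).
Local Notation z := (fun y => zeta xi v x0 (y + x0) w).
Local Notation target := (eta * `|s| + a^-1).

Hypotheses (x0_in : inbox (RR - r) x0) (s_small : `|s| < theta) (eta01 : 0 <= eta <= 1).
Hypothesis zeta_small : forall x, inbox (2 * RR) (x - x0) ->
  `|zeta xi v x0 x w| <= 10^-1 * (a * (1 - v (x - x0))).
Hypothesis zeta_sqr : forall x, inbox r (x - x0) -> x != x0 ->
  zeta xi v x0 x w ^+ 2 <= 2 / D * (1 + `|s| * a) * (b * (eta / eps)) ^+ l1norm (x - x0).

Let eta0 : 0 <= eta. Proof. by case/andP: eta01. Qed.

Let box_sub y : inbox r y -> inbox RR (y + x0).
Proof. by move=> yr; rewrite -[RR](subrKC r) inboxD. Qed.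

Let x0_box : inbox RR x0. Proof. by have := box_sub box0; rewrite add0r. Qed.

Let zetaE y : z y = xi (y + x0) w - xi x0 w * v y.
Proof. by rewrite /zeta addrK. Qed.

Lemma field_well : well_at RR field m x0.
Proof.
move=> x xR xx0; have x_x0 : x - x0 != 0 by rewrite subr_eq0.
have : inbox (2 * RR) (x - x0) by rewrite mulr_natl mulr2n inboxD// inboxN.
move=> /zeta_small/(le_trans (ler_norm _)); rewrite /zeta.
have v_le := one_sub_cov_ge v_bounds x_x0; have v_ge0 := one_sub_cov_ge0 (x - x0).
have xi_ge : 2 / 3 * a <= xi x0 w.
  by have := theta_le; have := s_small; rewrite ltr_norml => /andP[+ _]; lra.
have : 2 / 3 * a * (1 - v (x - x0)) <= xi x0 w * (1 - v (x - x0)) by exact: ler_wpM2r.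
have : m <= a / 2 * (1 - v (x - x0)) by rewrite ler_wpM2l// divr_ge0// ltW.
have : 0 <= a * (1 - v (x - x0)) by rewrite mulr_ge0// ltW.
by lra.
Qed.

Local Notation W := (potential_error barV field x0).

Lemma potential_error_zeta y : W y = z y - s * (1 - v y).
Proof. by rewrite /potential_error zetaE; ring. Qed.

Let target_ge : a^-1 <= target. Proof. by rewrite lerDr mulr_ge0. Qed.

Lemma zeta_mass : \sum_(y <- box d r) z y ^+ 2 * phibar y ^+ 2 <= zeta_const / 2 * target.
Proof.
rewrite -sum_box_neq0; last by rewrite zetaE add0r v0 mulr1 subrr expr0n mul0r.
have p0 : 0 <= b * (eta / eps) by rewrite mulr_ge0// divr_ge0// ltW.
have A0 : 0 <= 2 / D * (1 + `|s| * a).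
  by rewrite mulr_ge0 ?divr_ge0 ?addr_ge0 ?mulr_ge0 ?(ltW D0) ?(ltW a0).
have q2E : b * (eta / eps) * q ^+ 2 = b * eta * (K ^+ 2 * eps).
  by rewrite /q; field; rewrite !gt_eqF.
have b_eta : b * eta <= b ^+ 2.
  by rewrite expr2 ler_wpM2l// (le_trans _ b1)//; case/andP: eta01.
have q2_small : b * (eta / eps) * q ^+ 2 <= 2^-1.
  rewrite q2E; apply: le_trans bK2_eps; rewrite -[leRHS]mulrA.
  by apply: ler_wpM2r b_eta; rewrite mulr_ge0 ?sqr_ge0// ltW.
have z_sqr y : inbox r y -> y != 0 ->
    z y ^+ 2 <= 2 / D * (1 + `|s| * a) * (b * (eta / eps)) ^+ l1norm y.
  by move=> yr y0; have := @zeta_sqr (y + x0); rewrite -subr_eq0 addrK; apply.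
apply: le_trans (weighted_mass_le q0 bar_ge0 phibar_decay A0 p0 q2_small z_sqr) _; rewrite q2E.
have -> : 2 / D * (1 + `|s| * a) * (geo * (b * eta * (K ^+ 2 * eps))) =
    zeta_const / 2 * (eta * `|s| + eta * a^-1).
  by rewrite /zeta_const; field; rewrite !gt_eqF.
rewrite ler_wpM2l ?divr_ge0 ?zeta_const_ge0// lerD2l ler_piMl ?invr_ge0 ?(ltW a0)//.
by case/andP: eta01.
Qed.

Lemma sqr_height_mass :
  s ^+ 2 * \sum_(y <- box d r) (1 - v y) ^+ 2 * phibar y ^+ 2 <= theta * b * height_const * target.
Proof.
apply: (@le_trans _ _ (theta ^+ 2 * (D^-1 ^+ 2 * (geo * (b ^+ 2 * q ^+ 2))))).
  rewrite ler_pM ?sqr_ge0 ?sqr_one_sub_cov_mass//.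
    by apply: sumr_ge0 => y _; rewrite mulr_ge0 ?sqr_ge0.
  by rewrite -[leLHS]real_normK ?num_real// lerXn2r ?nnegrE// ltW.
have -> : theta ^+ 2 * (D^-1 ^+ 2 * (geo * (b ^+ 2 * q ^+ 2))) =
    theta * b * height_const * (a^-1 * a^-1).
  by rewrite /q /height_const; field; rewrite !gt_eqF.
apply: ler_wpM2l; first by rewrite mulr_ge0 ?height_const_ge0// mulr_ge0.
apply: le_trans target_ge.
by rewrite ler_piMr ?invr_ge0 ?(ltW a0)// invf_le1.
Qed.

Lemma height_mass :
  `|s * \sum_(y <- box d r) (1 - v y) * phibar y ^+ 2| <= height_const * eps * target.
Proof.
have mass0 : 0 <= \sum_(y <- box d r) (1 - v y) * phibar y ^+ 2.
  by apply: sumr_ge0 => y _; rewrite mulr_ge0 ?sqr_ge0 ?one_sub_cov_ge0.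
rewrite normrM (ger0_norm mass0).
apply: (@le_trans _ _ (theta * (D^-1 * (geo * (b * q ^+ 2))))).
  by rewrite ler_pM ?one_sub_cov_mass// ltW.
have -> : theta * (D^-1 * (geo * (b * q ^+ 2))) = height_const * eps * a^-1.
  by rewrite /q /height_const; field; rewrite !gt_eqF.
by rewrite ler_wpM2l// mulr_ge0 ?height_const_ge0// ltW.
Qed.

Lemma potential_error_sqr_mass :
  \sum_(y <- box d r) W y ^+ 2 * phibar y ^+ 2 <=
  (zeta_const + 2 * (theta * b) * height_const) * target.
Proof.
apply: (@le_trans _ _ (2 * (\sum_(y <- box d r) z y ^+ 2 * phibar y ^+ 2) +
    2 * (s ^+ 2 * \sum_(y <- box d r) (1 - v y) ^+ 2 * phibar y ^+ 2))).
  rewrite !mulr_sumr -big_split/=; apply: ler_sum => y _; rewrite potential_error_zeta.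
  move: (1 - v y) (zeta xi v x0 (y + x0) w) (phibar y) => t u p.
  by have := sqr_ge0 ((u + s * t) * p); lra.
by have := zeta_mass; have := sqr_height_mass; lra.
Qed.

Local Notation rho := (residual field (lbar + xi x0 w) (transplant phibar x0)).

Lemma sqnorm_residual_le : sqnorm RR rho <= residual_const * target.
Proof.
apply: le_trans (sqnorm_residual_transplant_le field r0 box_sub bar_eig) _.
rewrite /residual_const [leRHS]mulrDl; apply: lerD potential_error_sqr_mass _.
apply: (@le_trans _ _ (deg ^+ 2 * (2 / a) * (1 + geo))).
  rewrite ler_pM ?l1norm_mass//.
  - by rewrite mulr_ge0 ?sqr_ge0 ?divr_ge0 ?(ltW r0).
  - by apply: sumr_ge0 => y _; rewrite mulr_ge0 ?sqr_ge0.
  - by rewrite ler_wpM2l ?sqr_ge0// ler_wpM2l// lef_pV2.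
rewrite (_ : _ * _ = 2 * deg ^+ 2 * (1 + geo) * a^-1); last by ring.
by rewrite ler_wpM2l// !mulr_ge0 ?addr_ge0.
Qed.

Variables (lam : R) (phi : Zpt d -> R).
Hypothesis phiP : principal_eigenpair RR field lam phi.

Local Notation psi := (transplant phibar x0).
Local Notation mu := (lbar + xi x0 w).

Let mu_ge : xi x0 w - deg <= mu.
Proof. by have := lbar_ge; lra. Qed.

Let psi_norm : sqnorm RR psi = 1.
Proof. by rewrite (sqnorm_transplant box_sub bar_eig). Qed.

Let psi_ge0 x : 0 <= psi x. Proof. exact: bar_ge0. Qed.

Let psi_supported : supported RR psi. Proof. exact: transplant_supported bar_eig. Qed.

Let target_ge0 : 0 <= target.
Proof. by apply: le_trans target_ge; rewrite invr_ge0 ltW. Qed.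

Lemma dot_residual_Phi : dot RR rho psi =
  Phi xi v r phibar x0 w - s * \sum_(y <- box d r) (1 - v y) * phibar y ^+ 2.
Proof.
rewrite (dot_residual_transplant field box_sub bar_eig) /Phi.
under [in RHS]eq_bigr do rewrite mulrC.
rewrite sum_box_neq0; last by rewrite zetaE v0 mulr1 add0r subrr mul0r.
rewrite mulr_sumr -sumrB; apply: eq_bigr => y _.
by rewrite potential_error_zeta; ring.
Qed.

Lemma localised_eigenvalue :
  `|lam - lbar - Xi xi v r phibar x0 w| <= error_const * eps * target.
Proof.
have := well_eigenvalue_perturbation well_depth_gt0 deep x0_box field_well phiP
  psi_supported psi_norm mu_ge.
rewrite dot_residual_Phi -ler_pdivlMl ?well_depth_gt0//.
set H := s * _; set X := lam - mu - _ => X_le.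
have -> : lam - lbar - Xi xi v r phibar x0 w = X - H by rewrite /X /Xi; ring.
apply: le_trans (ler_normB _ _) _.
have well_depthV : m^-1 * (4 * (residual_const * target)) = 8 / c * residual_const * eps * target.
  by rewrite /m; field; rewrite !gt_eqF.
have mV0 : 0 <= m^-1 by rewrite invr_ge0 ltW ?well_depth_gt0.
have : `|X| <= 8 / c * residual_const * eps * target.
  rewrite -well_depthV; apply: le_trans X_le _; rewrite ler_wpM2l// ler_wpM2l//.
  exact: sqnorm_residual_le.
have : 0 <= 8 / c * eps * target by rewrite mulr_ge0// mulr_ge0 ?(ltW eps0)// divr_ge0// ltW.
by have := height_mass; rewrite /error_const; lra.
Qed.

Lemma localised_eigenvector :
  l2box RR (fun x => phi x - phibar (x - x0)) <= error_const * eps * Num.sqrt target.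
Proof.
have := well_eigenvector_perturbation well_depth_gt0 deep x0_box field_well phiP psi_ge0
  psi_supported psi_norm mu_ge.
have m20 : 0 < m ^+ 2 by rewrite exprn_gt0 ?well_depth_gt0.
rewrite -ler_pdivlMl// => sq_le.
have C_ge : 8 / c * (residual_const + 1) <= error_const by rewrite lerDl height_const_ge0.
have rc0 : 0 <= residual_const by exact: residual_const_ge0.
have cC0 : 0 <= 8 / c * (residual_const + 1).
  by apply: mulr_ge0; [rewrite divr_ge0// ltW|rewrite addr_ge0].
have C0 : 0 <= error_const * eps by rewrite mulr_ge0 ?(ltW eps0)// (le_trans cC0).
rewrite -(ger0_norm C0) -sqrtr_sqr -sqrtrM ?sqr_ge0//; apply: ler_wsqrtr.
apply: le_trans sq_le _.
apply: (@le_trans _ _ ((m ^+ 2)^-1 * (8 * (residual_const * target)))).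
  by rewrite ler_wpM2l ?invr_ge0 ?(ltW m20)// ler_wpM2l// sqnorm_residual_le.
have -> : (m ^+ 2)^-1 * (8 * (residual_const * target)) =
    (8 / c) ^+ 2 * (residual_const / 2) * eps ^+ 2 * target.
  by rewrite /m; field; rewrite !gt_eqF.
rewrite [in leRHS]exprMn; apply: ler_wpM2r => //; apply: ler_wpM2r; first exact: sqr_ge0.
apply: le_trans (lerXn2r 2 _ _ C_ge); rewrite ?nnegrE ?(le_trans cC0)//.
rewrite (exprMn 2 (8 / c)); apply: ler_wpM2l; first exact: sqr_ge0.
by have := sqr_ge0 residual_const; lra.
Qed.

End localisation.

(** * Moments of Gaussian variables *)

Section normal_moments.
Import numFieldNormedType.Exports.
Context {R : realType}.
Local Notation mu := (@lebesgue_measure R).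
Implicit Types (m s x : R).

Lemma is_derive_normal_pdf m s x : s != 0 ->
  is_derive x 1 (normal_pdf m s) (- ((x - m) / s ^+ 2) * normal_pdf m s x).
Proof.
move=> s0; rewrite normal_pdfE//.
have exponent : is_derive x 1 (fun y => - (y - m) ^+ 2 / (s ^+ 2 *+ 2)) (- ((x - m) / s ^+ 2)).
  by apply: is_derive_eq; rewrite /GRing.scale/=; field.
have -> : normal_peak s * normal_fun m s x = normal_peak s *: normal_fun m s x by [].
rewrite -scalerAr; apply: is_deriveZ.
by rewrite mulrC; apply: is_derive1_comp.
Qed.

Lemma mulr_normal_pdf_le s x : s != 0 -> 0 < x ->
  x * normal_pdf 0 s x <= 2 * s ^+ 2 * normal_peak s * x^-1.
Proof.
move=> s0 x0; have s20 : 0 < s ^+ 2 by rewrite exprn_even_gt0.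
rewrite normal_pdfE// /normal_fun subr0 mulNr expRN.
have := expR_ge1Dx (x ^+ 2 / (s ^+ 2 *+ 2)); set e := expR _ => e_ge.
have e0 : 0 < e by exact: expR_gt0.
have xe : x ^+ 2 <= 2 * s ^+ 2 * e.
  have -> : 2 * s ^+ 2 * e = e * (s ^+ 2 *+ 2) by ring.
  by rewrite -ler_pdivrMr ?mulrn_wgt0//; lra.
have -> : x * (normal_peak s * e^-1) = normal_peak s * (x^-1 * e^-1) * x ^+ 2.
  by field; rewrite !gt_eqF.
have -> : 2 * s ^+ 2 * normal_peak s * x^-1 =
    normal_peak s * (x^-1 * e^-1) * (2 * s ^+ 2 * e).
  by field; rewrite !gt_eqF.
apply: ler_wpM2l => //.
by rewrite mulr_ge0 ?normal_peak_ge0// mulr_ge0// invr_ge0 ltW.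
Qed.

Lemma cvg_mulr_normal_pdf s : s != 0 -> x * normal_pdf 0 s x @[x --> +oo] --> 0.
Proof.
move=> s0; pose C := 2 * s ^+ 2 * normal_peak s.
apply: (@squeeze_cvgr _ _ _ _ (cst 0) (fun x => C * x^-1)).
- near=> x; have x0 : 0 < x by near: x; exact: nbhs_pinfty_gt.
  by rewrite mulr_normal_pdf_le// mulr_ge0 ?normal_pdf_ge0// ltW.
- exact: cvg_cst.
- rewrite -[X in _ --> X](mulr0 C); apply: cvgMr; apply/gtr0_cvgV0; last exact: cvg_id.
  exact: nbhs_pinfty_gt.
Unshelve. all: by end_near. Qed.

Lemma derivable_LRcontinuous (f : R -> R) a b :
  (forall x, derivable f x 1) -> derivable_oo_LRcontinuous f a b.
Proof.
move=> df; have cf x : {for x, continuous f}.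
  by apply/differentiable_continuous; rewrite -derivable1_diffP.
by split=> [x _||]; [exact: df|exact/cvg_at_right_filter/cf|exact/cvg_at_left_filter/cf].
Qed.

Lemma integral_sqr_normal_pdf s b : s != 0 -> 0 < b ->
  (\int[mu]_(x in `[0%R, b]) (x ^+ 2 * normal_pdf 0 s x)%:E =
   (- s ^+ 2 * (b * normal_pdf 0 s b))%:E +
   (s ^+ 2)%:E * \int[mu]_(x in `[0%R, b]) (normal_pdf 0 s x)%:E)%E.
Proof.
move=> s0 b0; set p := normal_pdf 0 s.
have dp x : is_derive x 1 p (- (x / s ^+ 2) * p x).
  by have := is_derive_normal_pdf 0 x s0; rewrite subr0.
have dsp x : is_derive x 1 (fun y => - s ^+ 2 * p y) (x * p x).
  have -> : x * p x = - s ^+ 2 *: (- (x / s ^+ 2) * p x).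
    by rewrite /GRing.scale/=; field.
  exact: is_deriveZ.
under eq_integral do rewrite expr2 -mulrA.
rewrite (@integration_by_parts R id (fun x => - s ^+ 2 * p x) (cst 1))//=.
- rewrite mul0r subr0 mulrCA; under eq_integral do rewrite mul1r EFinM.
  rewrite integralZl//; first by rewrite EFinN mulNe oppeK.
  exact: integrableS (integrable_normal_pdf 0 s).
- exact: cst_continuous.
- by apply: derivable_LRcontinuous => x.
- by move=> x _; rewrite derive1_id.
- apply: continuous_subspaceT => x; apply: continuousM => //.
  exact: continuous_normal_pdf.
- by apply: derivable_LRcontinuous => x; have [] := dsp x.
- by move=> x _; rewrite derive1E; have [] := dsp x.
Qed.

Lemma integral0y_sqr_normal_pdf s : s != 0 ->
  (\int[mu]_(x in `[0%R, +oo[) (x ^+ 2 * normal_pdf 0 s x)%:E =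
   (s ^+ 2)%:E * \int[mu]_(x in `[0%R, +oo[) (normal_pdf 0 s x)%:E)%E.
Proof.
move=> s0; set p := normal_pdf 0 s.
pose J (f : R -> R) n := (\int[mu]_(x in `[0%R, n.+1%:R]) (f x)%:E)%E.
have cvgJ (f : R -> R) : (forall x, 0 <= f x) -> measurable_fun setT f ->
    J f n @[n --> \oo] --> (\int[mu]_(x in `[0%R, +oo[) (f x)%:E)%E.
  move=> f0 mf; rewrite (cvg_shiftS (fun n => (\int[mu]_(x in `[0%R, n%:R]) (f x)%:E)%E)).
  exact: ge0_cvgn_integral.
have p0 x : 0 <= p x := normal_pdf_ge0 0 s x.
have mp : measurable_fun setT p := measurable_normal_pdf 0 s.
have boundary : - s ^+ 2 * (n.+1%:R * p n.+1%:R) @[n --> \oo] --> 0.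
  rewrite -[X in _ --> X](mulr0 (- s ^+ 2)); apply: cvgMr.
  have /cvg_pinftyP := cvg_mulr_normal_pdf s0; apply.
  by rewrite (cvg_shiftS (fun n => n%:R : R)); exact: cvgr_idn.
have lim_by_parts : J (fun x => x ^+ 2 * p x) n @[n --> \oo] -->
    ((s ^+ 2)%:E * \int[mu]_(x in `[0%R, +oo[) (p x)%:E)%E.
  under eq_fun do rewrite /J integral_sqr_normal_pdf//.
  rewrite -[((s ^+ 2)%:E * \int[mu]_(x in `[0%R, +oo[) _)%E]add0e.
  apply: cvgeD => //; last by apply: cvgeZl => //; exact: cvgJ.
  by apply: cvg_EFin => //; exact: nearW.
apply: cvg_unique lim_by_parts => //; apply: cvgJ => [x|].
  by rewrite mulr_ge0 ?sqr_ge0.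
by apply: measurable_funM => //; exact: measurable_funX.
Qed.

Lemma normal_pdfN s x : s != 0 -> normal_pdf 0 s (- x) = normal_pdf 0 s x.
Proof. by move=> s0; rewrite !normal_pdfE// /normal_fun !subr0 sqrrN. Qed.

Lemma integral_even_normal_pdf (f : R -> R) s : s != 0 ->
  (forall x, 0 <= f x) -> continuous f -> f =1 f \o -%R ->
  (\int[mu]_x (f x * normal_pdf 0 s x)%:E =
   2%:E * \int[mu]_(x in `[0%R, +oo[) (f x * normal_pdf 0 s x)%:E)%E.
Proof.
move=> s0 f0 cf evenf; rewrite ge0_symfun_integralT//.
- by rewrite -set_itvcy.
- by move=> x; rewrite mulr_ge0 ?normal_pdf_ge0.
- by move=> x; apply: continuousM; [exact: cf|exact: continuous_normal_pdf].
- by move=> x /=; rewrite evenf normal_pdfN.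
Qed.

Lemma ge0_integral_normal_prob m s (f : measurableTypeR R -> \bar R) :
  (forall x, 0 <= f x)%E -> measurable_fun [set: R] f ->
  (\int[normal_prob m s]_x f x = \int[mu]_x (f x * (normal_pdf m s x)%:E))%E.
Proof.
move=> f0 mf; have dom := normal_prob_dominates m s.
rewrite -(Radon_Nikodym_SigmaFinite.change_of_variables dom)//.
apply: ae_eq_integral => //.
- apply: emeasurable_funM => //.
  exact: measurable_int (Radon_Nikodym_SigmaFinite.f_integrable dom).
- apply: emeasurable_funM => //; apply/measurable_EFinP.
  exact: measurable_normal_pdf.
- apply: ae_eqe_mul2l => /=; apply: integral_ae_eq => //=.
  + exact: Radon_Nikodym_SigmaFinite.f_integrable.
  + by apply/measurable_EFinP; exact: measurable_normal_pdf.
  + by move=> E _ mE; rewrite -Radon_Nikodym_SigmaFinite.f_integral.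
Qed.

Lemma normal_prob_second_moment s : s != 0 ->
  (\int[normal_prob 0 s]_x (x ^+ 2)%:E = (s ^+ 2)%:E)%E.
Proof.
move=> s0; rewrite ge0_integral_normal_prob//; last 2 first.
- by move=> x; rewrite lee_fin sqr_ge0.
- by apply/measurable_EFinP; exact: measurable_funX.
under eq_integral do rewrite -EFinM.
rewrite (@integral_even_normal_pdf (fun x => x ^+ 2))//; last 3 first.
- by move=> x; exact: sqr_ge0.
- exact: sqr_continuous.
- by move=> x /=; rewrite sqrrN.
rewrite integral0y_sqr_normal_pdf// muleCA.
have := @integral_even_normal_pdf (cst 1) s s0.
under eq_integral do rewrite mul1r.
under [X in _ -> _ -> _ -> _ = (_ * X)%E]eq_integral do rewrite mul1r.
move=> <- //; last exact: cst_continuous.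
by rewrite integral_normal_pdf mule1.
Qed.

Lemma normal_prob_opp s (A : set R) : s != 0 -> measurable A ->
  normal_prob 0 s (-%R @^-1` A) = normal_prob 0 s A.
Proof.
move=> s0 mA; rewrite /normal_prob.
under eq_integral do rewrite -normal_pdfN//.
rewrite -[LHS]/(\int[mu]_(x in -%R @^-1` A) ((EFin \o normal_pdf 0 s) \o -%R) x)%E.
have mN : measurable_fun setT (-%R : measurableTypeR R -> measurableTypeR R) by [].
rewrite -(ge0_integral_pushforward mN)//.
- by apply: eq_measure_integral => B mB _; exact: lebesgue_measureN.
- by apply/measurable_EFinP/measurable_funTS; exact: measurable_normal_pdf.
- by move=> x _; rewrite lee_fin normal_pdf_ge0.
Qed.

End normal_moments.

Section gaussian_variable.
Context {R : realType} {dT : measure_display} {T : measurableType dT}.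
Variables (P : probability T R) (X : T -> R) (s2 : R).
Hypotheses (mX : measurable_fun setT X) (s20 : 0 < s2).
Hypothesis lawX : forall A, measurable A -> P (X @^-1` A) = centred_gaussian_law s2 A.

Let s := Num.sqrt s2.
Let s_neq0 : s != 0. Proof. by rewrite gt_eqF ?sqrtr_gt0. Qed.
Let s_sqr : s ^+ 2 = s2. Proof. by rewrite sqr_sqrtr ?ltW. Qed.

Let mX' : @measurable_fun _ _ T (measurableTypeR R) setT X. Proof. exact: mX. Qed.
Let X' : {RV P >-> measurableTypeR R} := @mfun_Sub _ _ T (measurableTypeR R) X (mem_set mX').

Let lawXE A : measurable A -> P (X @^-1` A) = normal_prob 0 s A.
Proof. by move=> /lawX; rewrite /centred_gaussian_law gt_eqF. Qed.

Lemma gaussian_second_moment : (\int[P]_w (X w ^+ 2)%:E = s2%:E)%E.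
Proof.
rewrite -s_sqr -normal_prob_second_moment//.
rewrite -[LHS](@ge0_integral_distribution _ _ _ _ _ P X' (fun x => (x ^+ 2)%:E))//; last 2 first.
- by apply/measurable_EFinP; exact: measurable_funX.
- by move=> y; rewrite lee_fin sqr_ge0.
by apply: eq_measure_integral => A mA _; exact: lawXE.
Qed.

Lemma gaussian_Lfun2 : X \in Lfun P 2%:E.
Proof.
rewrite inE; apply/andP; split; rewrite inE//=.
rewrite /finite_norm unlock /Lnorm poweR_lty//.
under eq_integral do rewrite abse_EFin poweR_EFin powR_mulrn// -normrX ger0_norm ?sqr_ge0//.
by rewrite gaussian_second_moment ltry.
Qed.

Lemma expectation_gaussian : ('E_P[X] = 0)%E.
Proof.
have X1 : X \in Lfun P 1 by rewrite Lfun_subset12 ?gaussian_Lfun2 ?fin_num_measure.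
have iX : P.-integrable setT (EFin \o X) by exact/Lfun1_integrable.
have mXN : @measurable_fun _ _ T (measurableTypeR R) setT (\- X).
  by apply: (@measurableT_comp _ _ _ _ _ _ (-%R : R -> R)).
have mN : measurable_fun setT (-%R : R -> R) by [].
have E_fin := expectation_fin_num X1.
suff E_opp : ('E_P[X] = - 'E_P[X])%E.
  by move: E_opp E_fin; case: ('E_P[X])%E => // r [] rN _; congr (_%:E); lra.
rewrite [in RHS]unlock -integralN ?integrable_add_def//= unlock.
rewrite -[LHS](@integral_pushforward _ _ _ _ _ _ mX' P setT EFin _ _ measurableT)//.
rewrite -[RHS](@integral_pushforward _ _ _ _ _ _ mXN P setT EFin _ _ measurableT)//.
  apply: eq_measure_integral => A mA _.
  have mNA : measurable (-%R @^-1` A) by have := mN measurableT _ mA; rewrite setTI.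
  by rewrite -[LHS]/(P (X @^-1` A)) -[RHS]/(P (X @^-1` (-%R @^-1` A))) !lawXE// normal_prob_opp.
exact: (integrableN iX).
Qed.

Lemma variance_gaussian : ('V_P[X] = s2%:E)%E.
Proof.
rewrite varianceE ?gaussian_Lfun2// expectation_gaussian expe2 mule0 sube0.
by rewrite unlock gaussian_second_moment.
Qed.

End gaussian_variable.

Section zeta_moments.
Context {R : realType} {dT : measure_display} {T : measurableType dT} {d : nat}.
Variables (P : probability T R) (xi : Zpt d -> T -> R) (v : Zpt d -> R).
Hypotheses (gaussian_xi : gaussian_field P xi v) (v0 : v 0 = 1).

Lemma measurable_zeta x0 x : measurable_fun setT (zeta xi v x0 x).
Proof. by case: gaussian_xi => mxi _; apply: measurable_funB => //; exact: measurable_funM. Qed.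

Lemma zeta_law x0 x A : measurable A ->
  P (zeta xi v x0 x @^-1` A) = centred_gaussian_law (1 - v (x - x0) * v (x0 - x)) A.
Proof.
move=> mA; have [_ /(_ [:: (x, 1); (x0, - v (x - x0))] A mA)] := gaussian_xi.
rewrite !big_cons !big_nil/= !subrr v0.
have -> : (fun w => \sum_(p <- [:: (x, 1); (x0, - v (x - x0))]) p.2 * xi p.1 w) =
    zeta xi v x0 x.
  by apply/funext => w; rewrite !big_cons big_nil/= /zeta; ring.
by move=> ->; congr centred_gaussian_law; ring.
Qed.

Lemma variance_zeta x0 x : v (x - x0) * v (x0 - x) < 1 ->
  ('V_P[zeta xi v x0 x] = (1 - v (x - x0) * v (x0 - x))%:E)%E.
Proof.
move=> v_lt1; apply: variance_gaussian; first exact: measurable_zeta.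
  by rewrite subr_gt0.
exact: zeta_law.
Qed.

End zeta_moments.

(** * The event *)

Section event.
Context {R : realType} {dT : measure_display} {T : measurableType dT} {d : nat}.
Variables (P : probability T R) (xi : Zpt d -> T -> R) (v : Zpt d -> R).
Variables (c c' a D kappa : R).

Local Notation eps := (D / a).
Local Notation eta := (eps `^ (1 - 2 * kappa)).

Hypotheses (gaussian_xi : gaussian_field P xi v) (v0 : v 0 = 1).
Hypotheses (v_ge0 : forall x, 0 <= v x) (v_bounds : covariance_bounds c c' D v).
Hypotheses (c0 : 0 < c) (c'0 : 0 <= c') (kappa01 : 0 <= kappa <= 2^-1).
Hypotheses (D1 : 1 <= D) (Da : ratio_threshold d c c' * D <= a).

Let D0 : 0 < D. Proof. exact: lt_le_trans D1. Qed.

Let D_le_a : D <= a.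
Proof.
by apply: le_trans Da; rewrite ler_peMl ?(ltW D0)//; have := ratio_threshold_ge2 d c c'; lra.
Qed.

Let a0 : 0 < a. Proof. exact: lt_le_trans D_le_a. Qed.
Let eps0 : 0 < eps. Proof. exact: divr_gt0. Qed.

Let eta01 : 0 <= eta <= 1.
Proof.
rewrite powR_ge0 -[leRHS](powRr0 eps) ger_powR ?eps0 ?ler_pdivrMr ?mul1r//.
by case/andP: kappa01; lra.
Qed.

Lemma sqr_powR_enorm_le (y : Zpt d) :
  ((a / D) `^ (kappa * enorm y)) ^+ 2 <= (eta / eps) ^+ l1norm y.
Proof.
have -> : eta / eps = (a / D) `^ (2 * kappa).
  rewrite -[a / D]invf_div -[eps^-1]powR_inv1 ?(ltW eps0)//.
  rewrite -powRrM -powRD ?(gt_eqF eps0) ?implybT//.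
  by congr powR; ring.
rewrite -!powR_mulrn ?powR_ge0// -!powRrM ler_powR//.
  by rewrite ler_pdivlMr// mul1r.
by have /andP[k0 _] := kappa01; have := ler_wpM2l k0 (enorm_le_l1norm y); lra.
Qed.

Lemma zeta_sqr_le x0 x w : x != x0 ->
  `|zeta xi v x0 x w| / Num.sqrt (fine ('V_P[zeta xi v x0 x])%E)
     <= (a / D) `^ (kappa * enorm (x - x0)) *
        Num.sqrt (Num.max 1 (`|xi x0 w - a| * a)) ->
  zeta xi v x0 x w ^+ 2 <=
    2 / D * (1 + `|xi x0 w - a| * a) * (expR c' * (eta / eps)) ^+ l1norm (x - x0).
Proof.
move=> xx0; set y := x - x0; have y0 : y != 0 by rewrite subr_eq0.
have yN : x0 - x = - y by rewrite opprB.
have v_lt1 : v y * v (- y) < 1 by exact: covM_lt1 v_bounds _ _ _.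
rewrite variance_zeta ?yN//=; set V := 1 - _; set N := Num.max _ _.
have V0 : 0 < V by rewrite subr_gt0.
have sa0 : 0 <= `|xi x0 w - a| * a by rewrite mulr_ge0// ltW.
have N0 : 0 <= N by rewrite le_max ler01.
have N_le : N <= 1 + `|xi x0 w - a| * a by rewrite ge_max lerDl sa0 lerDr ler01.
move=> /(sqr_le_norm_div_sqrt V0 N0 (powR_ge0 _ _))/le_trans; apply.
rewrite exprMn; set q := (eta / eps) ^+ _; set e := expR c' ^+ _.
have -> : 2 / D * (1 + `|xi x0 w - a| * a) * (e * q) =
    q * (1 + `|xi x0 w - a| * a) * (2 / D * e) by ring.
apply: ler_pM; [by rewrite mulr_ge0 ?sqr_ge0|exact: ltW| |].
  by apply: ler_pM; rewrite ?sqr_ge0//; exact: sqr_powR_enorm_le.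
exact: one_sub_covM_le v_bounds _ _ _.
Qed.

Variables (r RR lbar : R) (phibar : Zpt d -> R) (x0 : Zpt d) (w : T).
Hypotheses (d0 : (0 < d)%N) (ar : a <= r) (x0_in : inbox (RR - r) x0).
Hypothesis barP : principal_eigenpair r (fun x => - (a * (1 - v x))) lbar phibar.
Hypothesis event : Eevent P xi v a D RR kappa x0 w.

Lemma localisation_on_event lam phi : principal_eigenpair RR (fun x => xi x w) lam phi ->
  `|lam - lbar - Xi xi v r phibar x0 w| <=
    error_const d c c' * eps * (eta * `|xi x0 w - a| + a^-1) /\
  l2box RR (fun x => phi x - phibar (x - x0)) <=
    error_const d c c' * eps * Num.sqrt (eta * `|xi x0 w - a| + a^-1).
Proof.
move=> phiP; have [s_small zeta_small zeta_std] := event.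
have r_le : r <= RR by have := inbox_ge0 d0 x0_in; rewrite subr_ge0.
have zeta_sqr x (xr : inbox r (x - x0)) (xx0 : x != x0) :=
  zeta_sqr_le xx0 (zeta_std x (le_inbox r_le xr) xx0).
split.
- exact: (localised_eigenvalue c0 c'0 D1 Da ar v0 v_bounds barP x0_in s_small eta01
    zeta_small zeta_sqr phiP).
- exact: (localised_eigenvector c0 c'0 D1 Da ar v0 v_bounds barP x0_in s_small eta01
    zeta_small zeta_sqr phiP).
Qed.

End event.

(** * Large scales *)

Section negligible_sequences.
Context {R : realType}.
Implicit Types (u w : nat -> R).

Lemma negl_le_near u w (t : R) : 0 < t -> negl u w ->
  (\forall L \near \oo, 0 < w L) -> \forall L \near \oo, t * u L <= w L.
Proof.
move=> t0 [_ /cvgrPdist_le uw] w_gt0; have tV0 : 0 < t^-1 by rewrite invr_gt0.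
near=> L; have wL : 0 < w L by near: L.
have : `|0 - u L / w L| <= t^-1 by near: L; exact: uw.
rewrite sub0r normrN => /(le_trans (ler_norm _)).
by rewrite ler_pdivrMr// ler_pdivlMl.
Unshelve. all: by end_near. Qed.

Lemma negl_div_neq0_near u w w' : negl u (fun L => w L / w' L) ->
  \forall L \near \oo, w' L != 0.
Proof.
by case=> + _; apply: filterS => L; apply: contraNneq => ->; rewrite invr0 mulr0.
Qed.

Lemma negl_sqrt_gt0_near u w : negl u (fun L => Num.sqrt (w L)) ->
  \forall L \near \oo, 0 < w L.
Proof. by case=> + _; apply: filterS => L; rewrite sqrtr_eq0 -ltNge. Qed.

End negligible_sequences.

Section large_scales.
Context {R : realType} {d : nat}.

Lemma ler_of_ler_ln (x y : R) : 1 < x -> ln x <= ln y -> x <= y.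
Proof.
move=> x1; have lnx : 0 < ln x by exact: ln_gt0.
have [y0|/ln0 ->] := ltP 0 y; last by rewrite leNgt lnx.
by rewrite ler_ln// posrE (lt_trans ltr01).
Qed.

Definition axis_point (i : 'I_d) (N : nat) : Zpt d := [ffun j => if j == i then N%:Z else 0].

Lemma enorm_axis_point i N : enorm (axis_point i N) = N%:R :> R.
Proof.
rewrite /enorm (bigD1 i)//= big1 => [|j ji]; last by rewrite ffunE (negbTE ji) expr0n.
by rewrite ffunE eqxx addr0 sqrtr_sqr ger0_norm.
Qed.

(* A negative [D] would make [v >= 1] off the origin, against the decay of [v]. *)
Lemma covariance_scale_gt0 (c c' D rad : R) (v : Zpt d -> R) :
  (0 < d)%N -> D != 0 -> covariance_bounds c c' D v ->
  (forall x, rad <= enorm x -> v x * ln (enorm x) <= 2^-1) -> 0 < D.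
Proof.
move=> d0 D0 v_bounds v_decay; rewrite lt_neqAle eq_sym D0/= leNgt; apply/negP => D_lt0.
pose t := Num.max rad (expR 1); pose N := Num.bound t.
have t0 : 0 <= t by rewrite le_max expR_ge0 orbT.
have : t <= N%:R := ltW (archi_boundP t0).
rewrite ge_max => /andP[rad_le e_le].
pose x := axis_point (Ordinal d0) N.
have xE : enorm x = N%:R :> R := enorm_axis_point _ _.
have N0 : 0 < N%:R :> R := lt_le_trans (expR_gt0 1) e_le.
have x0 : x != 0.
  apply: contraTneq N0 => x0; rewrite -xE x0 /enorm big1 ?sqrtr0 ?ltxx// => i _.
  by rewrite ffunE expr0n.
have lnN : 1 <= ln (N%:R : R) by rewrite -[leLHS](expRK 1) ler_ln// posrE expR_gt0.
have v1 : 1 <= v x.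
  have /andP[+ _] := v_bounds x x0; apply: le_trans.
  by rewrite lerBrDr gerDl mulr_ge0_le0 ?expR_ge0// invr_le0 ltW.
have := v_decay x; rewrite xE => /(_ rad_le).
have : 1 * 1 <= v x * ln (N%:R : R) by apply: ler_pM.
lra.
Qed.

Variables (c c' : R) (v : nat -> Zpt d -> R) (D a r : nat -> R).
Hypotheses (d0 : (0 < d)%N) (v_ge0 : forall L x, 0 <= v L x).
Hypothesis v_decay : forall e : R, 0 < e -> exists L1 : nat, forall L : nat, (L1 <= L)%N ->
  forall x : Zpt d, expR (Num.sqrt (ln (L%:R : R))) <= enorm x -> v L x * ln (enorm x) <= e.
Hypothesis D_attained : forall L, exists x : Zpt d, enorm x = 1 :> R /\ v L x = 1 - (D L)^-1.
Hypothesis v_bounds : forall L, covariance_bounds c c' (D L) (v L).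
Hypothesis D_neq0 : \forall L \near \oo, D L != 0.

Lemma covariance_scale_ge1_near : \forall L \near \oo, 1 <= D L.
Proof.
have half_gt0 : 0 < 2^-1 :> R by rewrite invr_gt0.
have [L1 decay] := v_decay half_gt0.
near=> L; have D0 : 0 < D L.
  apply: (covariance_scale_gt0 d0 _ (v_bounds L) (decay L _)).
    by near: L.
  by near: L; exact: nbhs_infty_ge.
have [x [_ vx]] := D_attained L.
by have := v_ge0 L x; rewrite vx subr_ge0 invf_le1.
Unshelve. all: by end_near. Qed.

Hypothesis a_gt0 : \forall L \near \oo, 0 < a L.
Hypothesis ln_a_le : forall L : nat, (2 <= L)%N -> ln (a L) <= ln (r L).
Hypothesis negl_D : negl D a.

Lemma large_scales_near (t : R) : 2 <= t ->
  \forall L \near \oo, [/\ 1 <= D L, t * D L <= a L & a L <= r L].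
Proof.
move=> t2; have t0 : 0 < t by apply: lt_le_trans t2.
near=> L; have D1 : 1 <= D L by near: L; exact: covariance_scale_ge1_near.
have tD : t * D L <= a L by near: L; exact: negl_le_near.
split => //; apply: ler_of_ler_ln; last first.
  by apply: ln_a_le; near: L; exact: nbhs_infty_ge.
have : 2 * 1 <= t * D L by apply: ler_pM.
lra.
Unshelve. all: by end_near. Qed.

End large_scales.

Theorem theorem4p2 (R : realType) (d : nat) (kappa : R)
    (dT : measure_display) (T : measurableType dT)
    (P : nat -> probability T R)
    (xi : nat -> Zpt d -> T -> R) (v : nat -> Zpt d -> R)
    (dL a RL rL lbar : nat -> R) (phibar : nat -> Zpt d -> R) :
  (0 < d)%N ->
  0 < kappa < 3^-1 ->
  (* centred stationary Gaussian field, unit variance, non-negative covariance v_L *)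
  (forall L, gaussian_field (P L) (xi L) (v L)) ->
  (forall L, v L 0 = 1) ->
  (forall L x, 0 <= v L x) ->
  (* (I) *)
  (forall e : R, 0 < e -> exists L1 : nat, forall L : nat, (L1 <= L)%N ->
     forall x : Zpt d, expR (Num.sqrt (ln (L%:R : R))) <= enorm x ->
       v L x * ln (enorm x) <= e) ->
  (* d_L : sup_{|x|=1} v_L(x) = 1 - 1/d_L *)
  (forall L, (forall x : Zpt d, enorm x = 1 :> R -> v L x <= 1 - (dL L)^-1) /\
             (exists x : Zpt d, enorm x = 1 :> R /\ v L x = 1 - (dL L)^-1)) ->
  (* (II) *)
  (exists c c' : R, 0 < c /\ 0 < c' /\
     forall L (x : Zpt d), x != 0 ->
       1 - expR (c' * enorm x) / dL L <= v L x <= 1 - c / dL L) ->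
  (* a_L : P(xi_L(0) > a_L) = L^{-d} *)
  (forall L : nat, (2 <= L)%N ->
     P L [set w | a L < xi L 0 w] = ((L%:R : R) ^- d)%:E) ->
  (* scales R_L, r_L *)
  negl a (fun L => ln (RL L)) ->
  negl (fun L => ln (RL L)) (fun L => a L ^+ 2 / dL L) ->
  (forall L : nat, (2 <= L)%N -> ln (a L) <= ln (rL L)) ->
  negl (fun L => ln (rL L)) (fun L => Num.sqrt (a L)) ->
  (* principal eigenpair of Delta - S_L on Q_{r_L}, S_L = a_L (1 - v_L) *)
  (forall L, principal_eigenpair (rL L) (fun x => - (a L * (1 - v L x)))
                                 (lbar L) (phibar L)) ->
  (* standing assumptions: d_L << a_L, tau_L << a_L^{-1} (a_L/d_L)^{1/2} *)
  negl dL a ->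
  negl (fun L => Num.sqrt (fine ('V_(P L)[Phi (xi L) (v L) (rL L) (phibar L) 0%R])%E))
       (fun L => (a L)^-1 * Num.sqrt (a L / dL L)) ->
  exists C : R, 0 < C /\
  exists L0 : nat, (1 <= L0)%N /\
  forall L : nat, (L0 <= L)%N ->
  forall x0 : Zpt d, inbox (RL L - rL L) x0 ->
  forall w : T, Eevent (P L) (xi L) (v L) (a L) (dL L) (RL L) kappa x0 w ->
  forall (lam : R) (phi : Zpt d -> R),
    principal_eigenpair (RL L) (fun x => xi L x w) lam phi ->
    `|lam - lbar L - Xi (xi L) (v L) (rL L) (phibar L) x0 w|
      <= C * (dL L / a L) *
         ((dL L / a L) `^ (1 - 2 * kappa) * `|xi L x0 w - a L| + (a L)^-1)
    /\
    l2box (RL L) (fun x => phi x - phibar L (x - x0))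
      <= C * (dL L / a L) *
         Num.sqrt ((dL L / a L) `^ (1 - 2 * kappa) * `|xi L x0 w - a L| + (a L)^-1).
Proof.
move=> d0 kappa_range gaussian_xi v0 v_ge0 decay D_def [c [c' [c0 [c'0 v_bounds]]]].
move=> _ _ negl_lnR ln_a_le negl_ln_r barP negl_D _.
have kappa01 : 0 <= kappa <= 2^-1 by lra.
have [L0 _ large] := large_scales_near d0 v_ge0 decay (fun L => (D_def L).2) v_bounds
  (negl_div_neq0_near negl_lnR) (negl_sqrt_gt0_near negl_ln_r) ln_a_le negl_D
  (ratio_threshold_ge2 d c c').
exists (error_const d c c'); split; first exact: error_const_gt0.
exists L0.+1; split => // L /ltnW/large[D1 Da ar] x0 x0_in w event lam phi phiP.
exact: (localisation_on_event (gaussian_xi L) (v0 L) (v_ge0 L) (v_bounds L) c0 (ltW c'0)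
  kappa01 D1 Da d0 ar x0_in (barP L) event phiP).
Qed.
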